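(* Under the polynomial scenario assumption (the scenario distribution has support of size polynomial in the input and is given explicitly), there is a polynomial-time 2-approximation algorithm for the two-stage stochastic vertex cover problem with recourse and revocation (reservation).
   Context: Two-stage stochastic vertex cover with recourse and revocation (reservation): we are given a graph with vertex set $V$ and edge set $E$, vertex costs $\omega_v\ge 0$, parameters $0<\sigma<1$ and $\lambda>1$, and a probability distribution over scenarios $A\subseteq E$ with probabilities $P_A$. In the first stage one reserves a set $F_0\subseteq V$, paying $\sigma\omega_v$ for each $v\in F_0$. In the second stage, when scenario $A$ is revealed, one pays $(1-\sigma)\omega_v$ for each vertex of a chosen subset $F_1\subseteq F_0$ and buys further vertices $F_2\subseteq V$ at cost $\lambda\omega_v$ each, such that every edge in $A$ has an endpoint in $F_1\cup F_2$. The objective is to minimize $\sigma\,\omega(F_0)+(1-\sigma)\mathbb E[\omega(F_1)]+\lambda\,\mathbb E[\omega(F_2)]$, where $\omega(\cdot)$ denotes total cost. *)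

(* Defs.v *)
From HB Require Import structures.
From mathcomp Require Import all_boot all_order all_algebra.
Set Implicit Arguments.
Unset Strict Implicit.
Unset Printing Implicit Defensive.
Import Order.TTheory GRing.Theory Num.Theory.
Local Open Scope ring_scope.

(** * Two-stage stochastic vertex cover with reservation *)

Record instance (V : finType) := Instance {
  edges  : {set {set V}};
  cost   : V -> rat;
  sigma  : rat;
  lambda : rat;
  prob   : {set {set V}} -> rat
}.

Definition valid (V : finType) (I : instance V) : Prop :=
  [/\ forall e, e \in edges I -> #|e| = 2%N,
      forall v, 0 <= cost I v,
      0 < sigma I < 1,
      1 < lambda I
    & [/\ forall A, 0 <= prob I A,
          forall A, 0 < prob I A -> A \subset edges I
        & \sum_A prob I A = 1]].

(* The second-stage decisions [reused] (F_1) and [bought] (F_2) depend on the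
   revealed scenario. *)
Record solution (V : finType) := Solution {
  reserved : {set V};
  reused   : {set {set V}} -> {set V};
  bought   : {set {set V}} -> {set V}
}.

Definition feasible (V : finType) (I : instance V) (S : solution V) : Prop :=
  forall A, 0 < prob I A ->
    reused S A \subset reserved S /\
    forall e, e \in A -> exists2 v, v \in e & v \in reused S A :|: bought S A.

Definition total_cost (V : finType) (I : instance V) (F : {set V}) : rat :=
  \sum_(v in F) cost I v.

Definition expect (V : finType) (I : instance V) (X : {set {set V}} -> rat) :
    rat :=
  \sum_A prob I A * X A.

Definition objective (V : finType) (I : instance V) (S : solution V) : rat :=
  sigma I * total_cost I (reserved S)
  + (1 - sigma I) * expect I (fun A => total_cost I (reused S A))
  + lambda I * expect I (fun A => total_cost I (bought S A)).

(** * Random-access machine with logarithmic cost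

    Programs are structured; the memory consists of integer arrays, named by
    natural numbers and indexed by integers.  An array name is part of the
    program text, so that a program uses finitely many arrays.  Each operation
    is charged the bit lengths of all the integers it handles, indices
    included, so large integers do not come for free. *)

Definition bitlen (z : int) : nat := (trunc_log 2 `|z|%N).+1.

Inductive binop := Add | Sub | Mul | Div | Le | Eq.

Inductive expr :=
| Cst of int
| Get of nat & expr
| Bin of binop & expr & expr.

Inductive cmd :=
| Skip
| Set_ of nat & expr & expr
| Seq of cmd & cmd
| If of expr & cmd & cmd
| While of expr & cmd.

Definition memory := nat -> int -> int.

Definition update (m : memory) (a : nat) (i z : int) : memory :=
  fun b j => if (b == a) && (j == i) then z else m b j.

Definition binop_eval (o : binop) (x y : int) : int :=
  match o with
  | Add => x + y
  | Sub => x - y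
  | Mul => x * y
  | Div => (x %/ y)%Z
  | Le => (x <= y)%R%:Z
  | Eq => (x == y)%:Z
  end.

Fixpoint eval (m : memory) (e : expr) : int :=
  match e with
  | Cst z => z
  | Get a i => m a (eval m i)
  | Bin o e1 e2 => binop_eval o (eval m e1) (eval m e2)
  end.

Fixpoint eval_time (m : memory) (e : expr) : nat :=
  match e with
  | Cst z => bitlen z
  | Get a i => eval_time m i + bitlen (eval m i) + bitlen (eval m e)
  | Bin o e1 e2 =>
      eval_time m e1 + eval_time m e2 + bitlen (eval m e1) + bitlen (eval m e2)
  end%N.

(* [exec c m t m']: from memory [m], the program [c] halts after time [t] with
   memory [m'].  A test succeeds when its value is nonzero. *)
Inductive exec : cmd -> memory -> nat -> memory -> Prop :=
| exec_skip m : exec Skip m 1 m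
| exec_set m a i e :
    exec (Set_ a i e) m
      (eval_time m i + eval_time m e + bitlen (eval m i) + bitlen (eval m e))
      (update m a (eval m i) (eval m e))
| exec_seq c1 c2 m t1 m1 t2 m2 :
    exec c1 m t1 m1 -> exec c2 m1 t2 m2 -> exec (Seq c1 c2) m (t1 + t2) m2
| exec_if_true e c1 c2 m t m' :
    eval m e != 0 -> exec c1 m t m' ->
    exec (If e c1 c2) m (eval_time m e + t) m'
| exec_if_false e c1 c2 m t m' :
    eval m e = 0 -> exec c2 m t m' ->
    exec (If e c1 c2) m (eval_time m e + t) m'
| exec_while_true e c m t1 m1 t2 m2 :
    eval m e != 0 -> exec c m t1 m1 -> exec (While e c) m1 t2 m2 ->
    exec (While e c) m (eval_time m e + t1 + t2) m2
| exec_while_false e c m :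
    eval m e = 0 -> exec (While e c) m (eval_time m e) m.

Lemma exec_det c m t1 m1 t2 m2 :
  exec c m t1 m1 -> exec c m t2 m2 -> t1 = t2 /\ m1 = m2.
Proof.
move=> H; elim: H t2 m2 => {c m t1 m1} *;
  match goal with H : exec _ _ ?t ?m' |- _ = ?t /\ _ = ?m' =>
    inversion H; subst end;
  repeat match goal with
  | Hn : is_true (eval ?m ?e != 0), H0 : eval ?m ?e = 0 |- _ =>
      by rewrite H0 eqxx in Hn
  | IH : forall t m', exec ?c ?m t m' -> _, H : exec ?c ?m ?t ?m' |- _ =>
      case: (IH _ _ H) => ? ?; subst; clear IH
  end; by [].
Qed.

(* The input word is stored in array 0, from index 0 on; all other cells
   contain 0. *)
Definition load (w : seq int) : memory :=
  fun a i => if (a, i) is (0%N, Posz k) then nth 0 w k else 0.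

Definition word_size (w : seq int) : nat := (\sum_(z <- w) bitlen z)%N.

(** * Explicit representation of instances

    An edge is given by its two endpoints, in either order.  An instance is
    presented by a list [es] of its edges and a list [scs] of the scenarios of
    positive probability, each scenario being a list of edges.  The order of
    all these lists is arbitrary. *)

Definition edge_of (n : nat) (p : 'I_n * 'I_n) : {set 'I_n} := [set p.1; p.2].

Definition edge_set (n : nat) (s : seq ('I_n * 'I_n)) : {set {set 'I_n}} :=
  [set:: map (@edge_of n) s].

Definition enumerates (T : finType) (s : seq T) (A : {set T}) : Prop :=
  uniq s /\ s =i A.

Definition presents (n : nat) (I : instance 'I_n)
    (es : seq ('I_n * 'I_n)) (scs : seq (seq ('I_n * 'I_n))) : Prop :=
  [/\ enumerates (map (@edge_of n) es) (edges I),
      enumerates (map (@edge_set n) scs) [set A | 0 < prob I A]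
    & forall s, s \in scs -> uniq (map (@edge_of n) s)].

Definition enc_rat (q : rat) : seq int := [:: numq q; denq q].

Definition enc_edges (n : nat) (s : seq ('I_n * 'I_n)) : seq int :=
  (size s)%:Z :: flatten [seq [:: (val p.1)%:Z; (val p.2)%:Z] | p <- s].

Definition encode (n : nat) (I : instance 'I_n)
    (es : seq ('I_n * 'I_n)) (scs : seq (seq ('I_n * 'I_n))) : seq int :=
  n%:Z :: enc_edges es
  ++ flatten [seq enc_rat (cost I v) | v <- enum 'I_n]
  ++ enc_rat (sigma I) ++ enc_rat (lambda I)
  ++ (size scs)%:Z
  :: flatten [seq enc_rat (prob I (edge_set s)) ++ enc_edges s | s <- scs].

(* Hence the support of the distribution is at most linear in the input size. *)
Lemma size_scenarios (n : nat) (I : instance 'I_n) es scs :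
  (size scs <= word_size (encode I es scs))%N.
Proof.
have size_le w : (size w <= word_size w)%N.
  by rewrite /word_size -sum1_size; apply: leq_sum.
have size_flat : (size scs <= size (flatten
    [seq enc_rat (prob I (edge_set s)) ++ enc_edges s | s <- scs]))%N.
  elim: scs => //= s l IH; rewrite size_cat ltnS.
  by do 2 apply: leqW; apply: leq_trans IH (leq_addl _ _).
apply: leq_trans (size_le _); apply: leq_trans size_flat _.
rewrite /encode -(cat1s (size scs)%:Z) -(cat1s n%:Z) !size_cat.
by rewrite !addnA leq_addl.
Qed.

(* The output: array 1 holds the indicator of the reserved set; rows k of
   arrays 2 and 3 (cells k * n, ..., k * n + n - 1) hold the indicators of the
   second-stage sets in the k-th listed scenario. *)
Definition decode (n : nat) (scs : seq (seq ('I_n * 'I_n))) (m : memory) :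
    solution 'I_n :=
  let row a A :=
    [set v : 'I_n |
      m a (index A (map (@edge_set n) scs) * n + v)%N%:Z != 0] in
  Solution [set v : 'I_n | m 1%N (val v)%:Z != 0] (row 2%N) (row 3%N).

(* Main.v *)
(** The algorithm is a primal-dual one.  In the dual of the LP relaxation, each
    edge of each scenario A makes a nonnegative payment, which is received in
    full by both of its endpoints.  If [b] is the total received by v in A,
    then the constraints are

      [b <= lambda P_A w_v] and
      [sum_A max(0, b - (1 - sigma) P_A w_v) <= sigma w_v].

    The scenarios are treated one after the other.  In a scenario the payments
    are raised edge by edge (Bar-Yehuda and Even), the capacity of v being
    [min(lambda P_A w_v, (1 - sigma) P_A w_v + rem_v)], where [rem_v] is what is
    left of the budget [sigma w_v].  At the end v is reserved if [rem_v = 0]; it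
    is then reused where [b >= (1 - sigma) P_A w_v].  A vertex that is not
    reserved is bought where [b = lambda P_A w_v].  Each edge has a saturated
    endpoint, so this is feasible; v costs at most what it receives; and the
    payments, which are received twice, are by weak duality at most the cost of
    any solution.

    The running time is polynomial because, after multiplication by the product
    of all denominators of the input, only integers of linear length occur. *)

Require Import Defs.
From HB Require Import structures.
From mathcomp Require Import all_boot all_order all_algebra.
From mathcomp Require Import zify ring.
Set Implicit Arguments.
Unset Strict Implicit.
Unset Printing Implicit Defensive.
Import Order.TTheory GRing.Theory Num.Theory.
Local Open Scope ring_scope.

(* Concrete syntax for programs *)
Declare Scope expr_scope.
Delimit Scope expr_scope with X.
Bind Scope expr_scope with expr.
Notation "# z" := (Cst z%Z) (at level 1, format "# z") : expr_scope.
Notation "e1 + e2" := (Bin Add e1 e2) : expr_scope.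
Notation "e1 - e2" := (Bin Defs.Sub e1 e2) : expr_scope.
Notation "e1 * e2" := (Bin Mul e1 e2) : expr_scope.
Notation "e1 / e2" := (Bin Div e1 e2) : expr_scope.
Notation "e1 <= e2" := (Bin Le e1 e2) : expr_scope.
Notation "e1 == e2" := (Bin Eq e1 e2) : expr_scope.
Notation "a @ i" := (Get a i) (at level 2, i at level 1) : expr_scope.
Notation "! a" := (Get a (Cst 0)) (at level 2, a at level 1, format "! a") : expr_scope.
Notation "a @@ i ::= e" := (Set_ a i%X e%X) (at level 75, i at level 1).
Notation "a ::= e" := (Set_ a (Cst 0) e%X) (at level 75).
Notation "c1 ;; c2" := (Seq c1 c2) (at level 76, right associativity).

(** * Programs with bounded memory cells *)

Fixpoint reads (e : expr) : seq nat :=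
  match e with
  | Cst _ => [::]
  | Get a i => a :: reads i
  | Bin _ e1 e2 => reads e1 ++ reads e2
  end.

Fixpoint writes (c : cmd) : seq nat :=
  match c with
  | Skip => [::]
  | Set_ a _ _ => [:: a]
  | Seq c1 c2 => writes c1 ++ writes c2
  | If _ c1 c2 => writes c1 ++ writes c2
  | While _ c => writes c
  end.

(** The frame condition: it carries facts about arrays that a fragment does not write across that
    fragment. *)
Definition agree_off (s : seq nat) (m m' : memory) : Prop :=
  forall a j, a \notin s -> m' a j = m a j.

Lemma exec_agree_off c m t m' : exec c m t m' -> agree_off (writes c) m m'.
Proof.
elim=> {c m t m'} //=.
- by move=> m a i e b j; rewrite inE /update => /negPf ->.
- move=> c1 c2 m t1 m1 t2 m2 _ IH1 _ IH2 a j.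
  by rewrite mem_cat negb_or => /andP[H1 H2]; rewrite IH2 ?IH1.
- move=> e c1 c2 m t m' _ _ IH a j.
  by rewrite mem_cat negb_or => /andP[H1 H2]; rewrite IH.
- move=> e c1 c2 m t m' _ _ IH a j.
  by rewrite mem_cat negb_or => /andP[H1 H2]; rewrite IH.
- by move=> e c m t1 m1 t2 m2 _ _ IH1 _ IH2 a j H; rewrite IH2 ?IH1.
Qed.

Lemma eval_agree_off s m m' e :
  agree_off s m m' -> all (predC (mem s)) (reads e) -> eval m' e = eval m e.
Proof.
move=> H; elim: e => //= [a i IH /andP[ha hi]|o e1 IH1 e2 IH2].
  by rewrite IH // H.
by rewrite all_cat => /andP[h1 h2]; rewrite IH1 ?IH2.
Qed.

(* If all the cells are at most [M >= 2] in absolute value, then the value of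
   [e] is at most [M ^ esize e]. *)
Fixpoint esize (e : expr) : nat :=
  match e with
  | Cst z => `|z|.+1
  | Get _ i => (esize i).+1
  | Bin _ e1 e2 => esize e1 + esize e2
  end.

(** Evaluation time in units of the cell length [l.+1]. The [esize] terms pay for the lengths of
    operands and indices, the successor in [Get] for the cell that is read. *)
Fixpoint ecost (e : expr) : nat :=
  match e with
  | Cst z => `|z|.+1
  | Get _ i => (ecost i + esize i).+1
  | Bin _ e1 e2 => ecost e1 + ecost e2 + esize e1 + esize e2
  end.

(* [(ccost c).[W]] bounds, up to the word length, the running time of [c] when
   each loop makes at most [W] iterations per entry. *)
Fixpoint ccost (c : cmd) : {poly nat} :=
  match c with
  | Skip => 1
  | Set_ _ i e => (ecost i + ecost e + esize i + esize e)%N%:P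
  | Seq c1 c2 => ccost c1 + ccost c2
  | If e c1 c2 => (ecost e)%:P + ccost c1 + ccost c2
  | While e c => ((ecost e)%:P + ccost c) * ('X + 1)
  end.

(** The bound [N] is evaluated anew at each test; [i < N] is written [i + 1 <= N] because [Le] is
    the only order test. *)
Definition For (i : nat) (N : expr) (c : cmd) : cmd :=
  Seq (Set_ i (Cst 0) (Cst 0))
    (While (Bin Le (Bin Add (Get i (Cst 0)) (Cst 1)) N)
       (Seq c (Set_ i (Cst 0) (Bin Add (Get i (Cst 0)) (Cst 1))))).

Lemma esize_gt0 e : (0 < esize e)%N.
Proof. by elim: e => //= o e1 H1 e2 H2; rewrite addn_gt0 H1. Qed.

Lemma bitlen_le (k l : nat) (z : int) :
  (0 < k)%N -> (`|z| <= (2 ^ l) ^ k)%N -> (bitlen z <= k * l.+1)%N.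
Proof.
move=> k0; rewrite -expnM => /(leq_trunc_log 2); rewrite trunc_expnK // /bitlen.
nia.
Qed.

(** * A program logic with bounds on time and on cells *)

Section Logic.

Variables W l : nat.
Hypothesis W_le : (W <= 2 ^ l)%N.
Hypothesis l_gt0 : (0 < l)%N.

Definition bounded (m : memory) : Prop := forall a i, (`|m a i| <= 2 ^ l)%N.

Let M_ge2 : (2 <= 2 ^ l)%N.
Proof. by case: l l_gt0 => // k _; rewrite expnS leq_pmulr // expn_gt0. Qed.

Lemma eval_le m e : bounded m -> (`|eval m e| <= (2 ^ l) ^ esize e)%N.
Proof.
move=> bm; elim: e => [z|a i IH|o e1 IH1 e2 IH2] /=.
- exact: leq_trans (leqnSn _) (ltnW (ltn_expl _ M_ge2)).
- by apply: leq_trans (bm _ _) _; rewrite expnS leq_pmulr // !expn_gt0.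
set x := eval m e1 in IH1 *; set y := eval m e2 in IH2 *.
have ge2 e : (2 <= (2 ^ l) ^ esize e)%N.
  apply: leq_trans M_ge2 _.
  by rewrite -{1}(expn1 (2 ^ l)) leq_pexp2l ?esize_gt0 ?expn_gt0.
have h1 := ge2 e1; have h2 := ge2 e2; rewrite expnD.
(* Both bounds are at least 2, so [a + b <= a * b], which covers sums and differences; a quotient is
   at most its dividend in absolute value, and a test is 0 or 1. *)
move: ((2 ^ l) ^ esize e1)%N ((2 ^ l) ^ esize e2)%N h1 h2 IH1 IH2 => a b.
case: o => /= *.
- by apply: (@leq_trans (a + b)%N); [lia|nia].
- by apply: (@leq_trans (a + b)%N); [lia|nia].
- by rewrite abszM leq_mul.
- by apply: leq_trans (lez_div _ _) _; nia.
- by case: (x <= y) => /=; nia.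
- by case: (x == y) => /=; nia.
Qed.

Lemma bitlen_eval m e : bounded m -> (bitlen (eval m e) <= esize e * l.+1)%N.
Proof. by move=> bm; apply: bitlen_le (esize_gt0 e) (eval_le e bm). Qed.

Lemma eval_time_le m e : bounded m -> (eval_time m e <= ecost e * l.+1)%N.
Proof.
move=> bm; elim: e => [z|a i IH|o e1 IH1 e2 IH2] /=.
- exact: bitlen_eval (Cst z) bm.
- have := bitlen_eval i bm.
  have := @bitlen_le 1 l _ isT (bm a (eval m i)); nia.
- by have := bitlen_eval e1 bm; have := bitlen_eval e2 bm; nia.
Qed.

Lemma ccost_while e c :
  (ccost (While e c)).[W] = ((ecost e + (ccost c).[W]) * W.+1)%N.
Proof. by rewrite /= hornerM !hornerD !hornerC hornerX [(W + 1)%R]addn1. Qed.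

(** Total correctness with resources. The time bound depends only on the text of [c], on [W] and on
    [l], and boundedness is carried along, so that proofs about programs deal only with values. *)
Definition wp (c : cmd) (m : memory) (Q : memory -> Prop) : Prop :=
  bounded m -> exists t m',
    [/\ exec c m t m', (t <= (ccost c).[W] * l.+1)%N, bounded m' & Q m'].

Lemma wp_seq c1 c2 m Q :
  wp c1 m (fun m1 => wp c2 m1 Q) -> wp (Seq c1 c2) m Q.
Proof.
move=> H bm; have [t1 [m1 [e1 h1 b1 H2]]] := H bm.
have [t2 [m2 [e2 h2 b2 H3]]] := H2 b1.
exists (t1 + t2)%N, m2; split=> //; first exact: exec_seq e1 e2.
rewrite /= hornerD mulnDl; exact: leq_add.
Qed.

(** Only assignments change cells, so this is where sizes are checked. The check concerns the stored
    value; the length of the index is controlled by [esize i]. *)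
Lemma wp_set a i e m (Q : memory -> Prop) :
  (bounded m -> `|eval m e| <= 2 ^ l)%N ->
  Q (update m a (eval m i) (eval m e)) -> wp (Set_ a i e) m Q.
Proof.
move=> he HQ bm; eexists; eexists; split; [exact: exec_set | | | exact: HQ].
  have := eval_time_le i bm; have := eval_time_le e bm.
  have := bitlen_eval i bm; have := bitlen_eval e bm.
  by rewrite /= hornerC; nia.
by move=> b j; rewrite /update; case: ifP => // _; apply: he.
Qed.

Lemma wp_conseq c m (Q Q' : memory -> Prop) : wp c m Q ->
  (forall m', agree_off (writes c) m m' -> Q m' -> Q' m') -> wp c m Q'.
Proof.
move=> H HQ bm; have [t [m' [e h b h']]] := H bm.
by exists t, m'; split=> //; apply: HQ h'; apply: exec_agree_off e.
Qed.

Lemma exec_while_le e c (Inv : nat -> memory -> Prop) (N : nat) T m0 :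
  (forall k m, (k < N)%N -> bounded m -> Inv k m ->
     eval m e != 0 /\ exists t m',
       [/\ exec c m t m', (t <= T)%N, bounded m' & Inv k.+1 m']) ->
  (forall m, bounded m -> Inv N m -> eval m e = 0) ->
  bounded m0 -> Inv 0%N m0 ->
  exists t m', [/\ exec (While e c) m0 t m',
    (t <= (ecost e * l.+1 + T) * N.+1)%N, bounded m' & Inv N m'].
Proof.
move=> Hstep Hend b0 I0.
(* Induction on the number [d] of iterations left; the factor [d.+1] also pays for the final failing
   test. *)
suff {b0 I0} H d k m : (k + d = N)%N -> bounded m -> Inv k m ->
  exists t m', [/\ exec (While e c) m t m',
    (t <= (ecost e * l.+1 + T) * d.+1)%N, bounded m' & Inv N m'].
  exact: H b0 I0.
elim: d k m => [|d IH] k m hk bm Im.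
  rewrite addn0 in hk; subst k; exists (eval_time m e), m; split=> //.
    by apply: exec_while_false; apply: Hend.
  by have := eval_time_le e bm; nia.
have [|hn [t1 [m1 [e1 h1 b1 I1]]]] := Hstep k m _ bm Im; first by lia.
have [|t2 [m2 [e2 h2 b2 I2]]] := IH k.+1 m1 _ b1 I1; first by lia.
exists (eval_time m e + t1 + t2)%N, m2; split=> //.
  exact: exec_while_true e1 e2.
by have := eval_time_le e bm; nia.
Qed.

(** Since [N] reads nothing that the loop modifies, its value stays [n]. The frame relative to [m0]
    and the value of the counter are maintained by the rule itself, so [Inv] has to describe only
    what the body changes. *)
Lemma wp_for i N c m0 (n : nat) (Inv : nat -> memory -> Prop)
    (Q : memory -> Prop) :
  let mod := i :: writes c in
  i \notin writes c -> all (predC (mem mod)) (reads N) ->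
  (n <= W)%N -> eval m0 N = n ->
  Inv 0%N (update m0 i 0 0) ->
  (forall k m, (k < n)%N -> agree_off mod m0 m -> m i 0 = k -> Inv k m ->
     wp c m (fun m' => m' i 0 = k -> Inv k.+1 (update m' i 0 k.+1))) ->
  (forall m, agree_off mod m0 m -> Inv n m -> Q m) ->
  wp (For i N c) m0 Q.
Proof.
move=> mod inc Nmod nW eN I0 Istep HQ; apply: wp_seq; apply: wp_set => //=.
pose J k m := [/\ agree_off mod m0 m, m i 0 = k%:Z & Inv k m].
have guardE k m : J k m ->
    eval m (Bin Le (Bin Add (Get i (Cst 0)) (Cst 1)) N) = (k < n)%N.
  case=> h hi _; rewrite /= (eval_agree_off h) // eN hi; lia.
have agree_upd m z : agree_off mod m0 m -> agree_off mod m0 (update m i 0 z).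
  move=> h b j hb; rewrite /update; have [eb|_] := eqVneq b i; last exact: h.
  by rewrite eb mem_head in hb.
move=> b0.
have [||||t [m' [e h b [h1 _ h2]]]] :=
  @exec_while_le (Bin Le (Bin Add (Get i (Cst 0)) (Cst 1)) N)
    (Seq c (Set_ i (Cst 0) (Bin Add (Get i (Cst 0)) (Cst 1)))) J n
    ((ccost (Seq c (Set_ i (Cst 0) (Bin Add (Get i (Cst 0)) (Cst 1))))).[W]
      * l.+1) (update m0 i 0 0).
- move=> k m kn bm Jm; rewrite (guardE k m Jm) kn; split=> //.
  case: Jm => ha hi hI.
  suff H : wp (Seq c (Set_ i (Cst 0) (Bin Add (Get i (Cst 0)) (Cst 1)))) m (J k.+1).
    by have [t [m' [? ? ? ?]]] := H bm; exists t, m'.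
  apply: wp_seq; apply: wp_conseq (Istep k m kn ha hi hI) _ => m' hag h2.
  have hk : m' i 0 = k by rewrite hag.
  have eS : k%:Z + 1 = k.+1 by lia.
  apply: wp_set; rewrite /= hk eS => //; first by move=> _ /=; lia.
  split; last exact: h2.
    apply: agree_upd => a j hj; rewrite hag ?ha //.
    by move: hj; rewrite inE negb_or => /andP[].
  by rewrite /update !eqxx.
- by move=> m bm /guardE ->; rewrite ltnn.
- exact: b0.
- by split=> //; [apply: agree_upd | rewrite /update !eqxx].
- exists t, m'; split=> //; last exact: HQ.
  apply: leq_trans h _.
  by rewrite ccost_while -mulnDl mulnAC leq_mul // leq_mul.
Qed.

End Logic.

(** * The primal-dual scheme *)

Section PrimalDual.

Variable V : finType.
Implicit Types (r : V -> int) (p : V * V) (s : seq (V * V)).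

(** The greedy step of Bar-Yehuda and Even: the payment of [p] is the largest that both residual
    capacities allow. *)
Definition pay r p : V -> int :=
  fun x => r x - Num.min (r p.1) (r p.2) * ((x == p.1) || (x == p.2))%:Z.

Definition residual r s : V -> int := foldl pay r s.

Lemma pay_bounds r p : (forall v, 0 <= r v) -> forall v, 0 <= pay r p v <= r v.
Proof.
move=> r0 v; rewrite /pay; have := r0 v; have := r0 p.1; have := r0 p.2.
by case: eqP => [->|_]; [|case: eqP => [->|_]] => /=; lia.
Qed.

Lemma residual_bounds r s :
  (forall v, 0 <= r v) -> forall v, 0 <= residual r s v <= r v.
Proof.
elim: s r => [|p s IH] r r0 v /=; first by rewrite r0 lexx.
have hp := pay_bounds p r0.
have /andP[h1 h2] := IH (pay r p) (fun v => proj1 (andP (hp v))) v.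
by have /andP[_ h3] := hp v; rewrite h1 (le_trans h2 h3).
Qed.

(** The endpoint with the smaller residual drops to 0 when [p] is treated, and stays there because
    residuals never increase and never become negative. *)
Lemma residual_tight r s p :
  (forall v, 0 <= r v) -> p \in s -> residual r s p.1 = 0 \/ residual r s p.2 = 0.
Proof.
elim: s r => // q s IH r r0; rewrite inE /= => /orP[/eqP->|]; last first.
  by apply: IH => v; case/andP: (pay_bounds q r0 v).
have hq := pay_bounds q r0.
have hs := residual_bounds s (fun v => proj1 (andP (hq v))).
have e1 : pay r q q.1 = r q.1 - Num.min (r q.1) (r q.2).
  by rewrite /pay eqxx mulr1.
have e2 : pay r q q.2 = r q.2 - Num.min (r q.1) (r q.2).
  by rewrite /pay eqxx orbT mulr1.
have := hs q.1; have := hs q.2; rewrite -/(residual _ _) e1 e2.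
by have := r0 q.1; have := r0 q.2; lia.
Qed.

(** Every payment is received by exactly two vertices, hence counted twice on the left, and at least
    one of them lies in [C]. *)
Lemma residual_cover r s (C : {set V}) :
  (forall v, 0 <= r v) -> {in s, forall p, p.1 != p.2} ->
  {in s, forall p, (p.1 \in C) || (p.2 \in C)} ->
  \sum_v (r v - residual r s v) <= 2 * \sum_(v in C) (r v - residual r s v).
Proof.
elim: s r => [|p s IH] r r0 hne hC /=.
  by rewrite !big1 ?mulr0 // => v _; rewrite subrr.
have r1 v : 0 <= pay r p v by case/andP: (pay_bounds p r0 v).
have {}IH := IH _ r1 (fun q hq => hne q (@mem_behead _ (p :: s) _ hq))
  (fun q hq => hC q (@mem_behead _ (p :: s) _ hq)).
pose t : int := Num.min (r p.1) (r p.2).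
have t0 : 0 <= t by rewrite /t; have := r0 p.1; have := r0 p.2; lia.
(* The amount received at [v] splits into what comes from [s] and the payment [t] of [p]; the
   endpoints being distinct, the two indicators do not overlap. *)
have E v : r v - residual (pay r p) s v = (pay r p v - residual (pay r p) s v)
    + (t * (v == p.1)%:Z + t * (v == p.2)%:Z).
  have ne := hne p (mem_head _ _).
  suff -> : pay r p v = r v - (t * (v == p.1)%:Z + t * (v == p.2)%:Z) by lia.
  rewrite /pay -/t; case: (eqVneq v p.1) => [->|_] /=.
    by rewrite (negPf ne) /=; lia.
  by case: (v == p.2) => /=; lia.
have S x : \sum_v t * (v == x)%:Z = t.
  rewrite (bigD1 x) //= eqxx mulr1 big1 ?addr0 // => v /negPf ->.
  by rewrite mulr0.
have SC x : \sum_(v in C) t * (v == x)%:Z = t * (x \in C)%:Z.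
  case: (boolP (x \in C)) => xC.
    rewrite (bigD1 x) //= eqxx big1 ?addr0 // => v /andP[_ /negPf ->].
    by rewrite mulr0.
  rewrite big1 ?mulr0 // => v vC; case: eqP => [ev|]; last by rewrite mulr0.
  by rewrite -ev vC in xC.
rewrite (eq_bigr _ (fun v _ => E v)) [X in _ <= 2 * X](eq_bigr _ (fun v _ => E v)).
rewrite big_split [X in _ <= 2 * X]big_split /=.
rewrite [X in _ + X <= _]big_split [X in _ <= 2 * (_ + X)]big_split /= !S !SC.
move: IH (hC p (mem_head _ _)); move: (\sum_v _) (\sum_(v in C) _) => X Y.
by case: (p.1 \in C); case: (p.2 \in C) => //=; lia.
Qed.

Variables (s : nat -> seq (V * V)) (cap base : nat -> V -> int) (rem0 : V -> int).

(* [cap] and [base] stand for [lambda P_A w_v] and [(1 - sigma) P_A w_v] in the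
   k-th scenario, [rem0] for [sigma w_v]. *)
Definition limit (rem : V -> int) k v := Num.min (cap k v) (base k v + rem v).

Definition charge_from (rem : V -> int) k v :=
  limit rem k v - residual (limit rem k) (s k) v.

Fixpoint remaining k : V -> int :=
  if k is k'.+1 then
    fun v => remaining k' v
      - Num.max 0 (charge_from (remaining k') k' v - base k' v)
  else rem0.

Definition charge k := charge_from (remaining k) k.

Definition reserves K v := remaining K v == 0.
Definition reuses K k v := reserves K v && (base k v <= charge k v).
Definition buys K k v := ~~ reserves K v && (charge k v == cap k v).

Hypothesis base_ge0 : forall k v, 0 <= base k v.
Hypothesis base_le_cap : forall k v, base k v <= cap k v.
Hypothesis rem0_ge0 : forall v, 0 <= rem0 v.

Lemma load_on_bounds rem k v : (forall v, 0 <= rem v) ->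
  0 <= charge_from rem k v <= limit rem k v.
Proof.
move=> h; have H u : 0 <= limit rem k u.
  by rewrite /limit; have := base_ge0 k u; have := base_le_cap k u; have := h u; lia.
by rewrite /charge_from; have := residual_bounds (s k) H v; have := H v; lia.
Qed.

Lemma remaining_ge0 k v : 0 <= remaining k v.
Proof.
elim: k v => //= k IH v; have := load_on_bounds k v IH.
by rewrite /limit; have := IH v; lia.
Qed.

Lemma remaining_anti k K v : (k <= K)%N -> remaining K v <= remaining k v.
Proof.
elim: K => [|K IH]; first by rewrite leqn0 => /eqP ->.
rewrite leq_eqVlt => /orP[/eqP -> //|/IH h]; apply: le_trans h => /=; lia.
Qed.

Lemma limit_ge0 k v : 0 <= limit (remaining k) k v.
Proof.
rewrite /limit; have := base_ge0 k v; have := base_le_cap k v.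
by have := remaining_ge0 k v; lia.
Qed.

Lemma charge_bounds k v : 0 <= charge k v <= limit (remaining k) k v.
Proof. exact: load_on_bounds (remaining_ge0 k). Qed.

(** Together with [remaining_ge0] this yields the second dual constraint. *)
Lemma remaining_sum K v :
  rem0 v - remaining K v = \sum_(k < K) Num.max 0 (charge k v - base k v).
Proof.
elim: K => [|K IH]; first by rewrite big_ord0 subrr.
by rewrite big_ord_recr -IH /=  -/(charge K v); lia.
Qed.

(** A saturated endpoint [v] has charge [limit], which is at least [base], so it is reused if it is
    reserved in the end. Otherwise its budget is still positive after scenario [k]; then the budget
    was not the binding term of [limit], so the charge is [cap] and [v] is bought. *)
Lemma chosen_cover K k p : (k < K)%N -> p \in s k ->
  exists2 v, (v == p.1) || (v == p.2) & reuses K k v || buys K k v.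
Proof.
move=> kK ps.
have [v hv r0] : exists2 v, (v == p.1) || (v == p.2) &
    residual (limit (remaining k) k) (s k) v = 0.
  have [h|h] := residual_tight (limit_ge0 k) ps; first by exists p.1; rewrite ?eqxx.
  by exists p.2; rewrite ?eqxx ?orbT.
exists v => //.
have hb : charge k v = limit (remaining k) k v by rewrite /charge /charge_from r0 subr0.
have h1 := remaining_ge0 k v; have h2 := base_le_cap k v.
have bb : base k v <= charge k v by rewrite hb /limit; lia.
rewrite /reuses /buys bb andbT; case: (boolP (reserves K v)) => //= hR.
have := remaining_anti v kK; have := remaining_ge0 K v; rewrite /= -/(charge k v).
by move: hR; rewrite /reserves hb /limit; lia.
Qed.

(** If [v] is reserved, its budget is exhausted, so [rem0 v] equals the sum of the excesses of
    charge over base; base plus excess is the charge where [v] is reused, and the excess is 0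
    elsewhere. If [v] is not reserved, it pays [cap] only where the charge equals [cap]. *)
Lemma vertex_cost_le K v :
  rem0 v * (reserves K v)%:Z
  + \sum_(k < K) (base k v * (reuses K k v)%:Z + cap k v * (buys K k v)%:Z)
  <= \sum_(k < K) charge k v.
Proof.
rewrite /reuses /buys; case: (boolP (reserves K v)) => [/eqP hR|hR] /=.
  have := remaining_sum K v; rewrite hR subr0 mulr1 => ->.
  rewrite -big_split /=; apply: ler_sum => k _.
  have := charge_bounds k v; have := base_ge0 k v.
  by case: (boolP (base k v <= _)) => /=; lia.
rewrite mulr0 add0r; apply: ler_sum => k _.
by have := charge_bounds k v; case: eqP => /=; lia.
Qed.

Hypothesis s_neq : forall k, {in s k, forall p, p.1 != p.2}.

(** Weak duality, with the factor 2 coming from [residual_cover]. *)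
Lemma charge_le_cost K (F0 : {set V}) (F1 F2 : nat -> {set V}) :
  (forall k, (k < K)%N -> F1 k \subset F0) ->
  (forall k, (k < K)%N ->
     {in s k, forall p, (p.1 \in F1 k :|: F2 k) || (p.2 \in F1 k :|: F2 k)}) ->
  \sum_(k < K) \sum_v charge k v <=
  2 * (\sum_(v in F0) rem0 v
       + \sum_(k < K) (\sum_(v in F1 k) base k v + \sum_(v in F2 k) cap k v)).
Proof.
move=> hsub hcov.
(* On [F1 k] the charge is at most base plus excess, on [F2 k] at most [cap]; the excesses are then
   summed over the larger set [F0], which is the same for all scenarios. *)
have step (k : 'I_K) : \sum_v charge k v <=
    2 * (\sum_(v in F0) Num.max 0 (charge k v - base k v)
         + (\sum_(v in F1 k) base k v + \sum_(v in F2 k) cap k v)).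
  apply: le_trans (residual_cover (limit_ge0 k) (@s_neq k) (hcov k (ltn_ord k))) _.
  rewrite -/(charge_from _ _) -/(charge k) ler_pM2l //.
  (* Splitting the union only adds the nonnegative charges on the intersection. *)
  apply: (@le_trans _ _ (\sum_(v in F1 k) charge k v + \sum_(v in F2 k) charge k v)).
    rewrite [leRHS](_ : _ = \sum_(v in F1 k :|: F2 k) charge k v
       + \sum_(v in F1 k :&: F2 k) charge k v).
      by rewrite lerDl sumr_ge0 // => v _; case/andP: (charge_bounds k v).
    rewrite big_mkcond [X in _ + X]big_mkcond -big_split /= [X in _ = X + _]big_mkcond.
    rewrite [X in _ = _ + X]big_mkcond -big_split; apply: eq_bigr => v _ /=.
    rewrite !inE; by case: (v \in F1 k); case: (v \in F2 k); rewrite /= ?addr0 ?add0r.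
  rewrite addrA; apply: lerD; last first.
    by apply: ler_sum => v _; have := charge_bounds k v; rewrite /limit; lia.
  have h : \sum_(v in F1 k) Num.max 0 (charge k v - base k v)
           <= \sum_(v in F0) Num.max 0 (charge k v - base k v).
    rewrite [leRHS](big_setID (F1 k)) (setIidPr (hsub k (ltn_ord k))) lerDl.
    by apply: sumr_ge0 => v _; lia.
  apply: le_trans (lerD h (lexx _)); rewrite -big_split /=.
  by apply: ler_sum => v _; lia.
apply: le_trans (ler_sum _ (fun k _ => step k)) _.
rewrite -mulr_sumr ler_pM2l // big_split lerD2r exchange_big /=.
(* Over all scenarios the excesses at [v] add up to the part of the budget that was used. *)
apply: ler_sum => v _; rewrite -remaining_sum.
by have := remaining_ge0 K v; lia.
Qed.

Lemma primal_dual_2approx K (F0 : {set V}) (F1 F2 : nat -> {set V}) :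
  (forall k, (k < K)%N -> F1 k \subset F0) ->
  (forall k, (k < K)%N ->
     {in s k, forall p, (p.1 \in F1 k :|: F2 k) || (p.2 \in F1 k :|: F2 k)}) ->
  \sum_(v | reserves K v) rem0 v
  + \sum_(k < K) (\sum_(v | reuses K k v) base k v + \sum_(v | buys K k v) cap k v)
  <= 2 * (\sum_(v in F0) rem0 v
       + \sum_(k < K) (\sum_(v in F1 k) base k v + \sum_(v in F2 k) cap k v)).
Proof.
move=> hsub hcov; apply: le_trans (charge_le_cost hsub hcov).
have ifE (b : bool) (x : int) : (if b then x else 0) = x * b%:Z.
  by case: b; rewrite ?mulr1 ?mulr0.
rewrite exchange_big big_mkcond /= (eq_bigr (fun k : 'I_K => \sum_v
   (base k v * (reuses K k v)%:Z + cap k v * (buys K k v)%:Z))); last first.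
  move=> k _; rewrite big_split /= big_mkcond [X in _ + X]big_mkcond /=.
  by congr (_ + _); apply: eq_bigr => v _; rewrite ifE.
rewrite exchange_big -big_split /=; apply: ler_sum => v _.
by rewrite ifE; apply: vertex_cost_le.
Qed.

End PrimalDual.

(** * The input word *)

Lemma nth_cat_add (T : Type) (x0 : T) s1 s2 i :
  nth x0 (s1 ++ s2) (size s1 + i) = nth x0 s2 i.
Proof. by rewrite nth_cat ltnNge leq_addr /= addKn. Qed.

Lemma nth_flatten_map (T U : Type) (x0 : T) (y0 : U) (f : T -> seq U) s i j :
  (i < size s)%N -> (j < size (f (nth x0 s i)))%N ->
  nth y0 (flatten (map f s)) (\sum_(x <- take i s) size (f x) + j)
  = nth y0 (f (nth x0 s i)) j.
Proof.
elim: s i => // x s IH [|i] hi hj /=; first by rewrite big_nil nth_cat hj.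
by rewrite big_cons -addnA nth_cat_add IH.
Qed.

Lemma size_flatten_map (T U : Type) (f : T -> seq U) s :
  size (flatten (map f s)) = (\sum_(x <- s) size (f x))%N.
Proof. by elim: s => [|x s IH] /=; rewrite ?big_nil // size_cat IH big_cons. Qed.

Lemma sum_const_seq (T : Type) (s : seq T) k : (\sum_(x <- s) k)%N = (k * size s)%N.
Proof. by elim: s => [|x s IH]; rewrite ?big_nil ?muln0 // big_cons IH mulnS. Qed.

Lemma size_cons (T : Type) (x : T) s : size (x :: s) = (size s).+1.
Proof. by []. Qed.

Lemma loadE w k : load w 0%N (Posz k) = nth 0 w k.
Proof. by []. Qed.

Lemma word_size_cat s1 s2 : word_size (s1 ++ s2) = (word_size s1 + word_size s2)%N.
Proof. by rewrite /word_size big_cat. Qed.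

Lemma word_size_cons z s : word_size (z :: s) = (bitlen z + word_size s)%N.
Proof. by rewrite /word_size big_cons. Qed.

Lemma size_le_word_size s : (size s <= word_size s)%N.
Proof. by rewrite /word_size -sum1_size; apply: leq_sum. Qed.

Lemma ltn_bitlen z : (`|z| < 2 ^ bitlen z)%N.
Proof. exact: trunc_log_ltn. Qed.

Lemma nth_le_word_size (w : seq int) k : (`|(nth 0 w k)%R| <= 2 ^ word_size w)%N.
Proof.
have [hk|hk] := ltnP k (size w); last by rewrite nth_default.
rewrite -(cat_take_drop k w) word_size_cat (drop_nth 0 hk) word_size_cons.
rewrite nth_cat size_take hk ltnn subnn /=.
apply: leq_trans (ltnW (ltn_bitlen _)) _; rewrite leq_pexp2l //; lia.
Qed.

(** Bit lengths add up under multiplication, so a product of input numbers still has linear length.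
    All prefixes are covered because the program stores partial products. *)
Lemma prod_le_word_size (s : seq int) (i : nat) :
  (forall z, z \in s -> 0 < z) -> 0 < \prod_(z <- take i s) z <= 2 ^+ word_size s.
Proof.
elim: s i => [|z s IH] [|i] h /=; rewrite ?big_nil ?ltr01 ?exprn_ege1 //.
have /andP[h1 h2] := IH i (fun y hy => h y (@mem_behead _ (z :: s) _ hy)).
have z0 := h z (mem_head _ _).
rewrite big_cons mulr_gt0 //= word_size_cons exprD ler_pM // ?ltW //.
by have := ltn_bitlen z; rewrite -ltz_nat gtz0_abs // -[X in _ < X]natz natrX.
Qed.

Section Encoding.

Variables (n : nat) (I : instance 'I_n).
Variables (es : seq ('I_n * 'I_n)) (scs : seq (seq ('I_n * 'I_n))).

(** Offsets in the input word. Two cells hold [n] and the number of edges; each edge and each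
    rational takes two. The 5 counts sigma, lambda and the number of scenarios; the 3 counts the
    probability and the length of a scenario. *)
Definition cost_pos : nat := (2 + 2 * size es)%N.
Definition sigma_pos : nat := (cost_pos + 2 * n)%N.
Definition scenario_pos (k : nat) : nat :=
  (sigma_pos + 5 + \sum_(s <- take k scs) (3 + 2 * size s))%N.

Let w := encode I es scs.

Lemma size_enc_edges (s : seq ('I_n * 'I_n)) :
  size (enc_edges s) = (1 + 2 * size s)%N.
Proof. by rewrite /= size_flatten_map /= sum_const_seq. Qed.

Lemma enc_edges_nth (s : seq ('I_n * 'I_n)) x0 j b : (j < size s)%N -> (b < 2)%N ->
  nth 0 (enc_edges s) (1 + 2 * j + b) =
  nth 0 [:: (val (nth x0 s j).1)%:Z; (val (nth x0 s j).2)%:Z] b.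
Proof.
move=> hj hb; rewrite -addnA /=.
rewrite -(nth_flatten_map (x0 := x0) 0
  (f := fun p : 'I_n * 'I_n => [:: (val p.1)%:Z; (val p.2)%:Z])) //.
by rewrite /= sum_const_seq size_takel // ltnW.
Qed.

Let costs := flatten [seq enc_rat (cost I v) | v <- enum 'I_n].
Let scenarios := flatten [seq enc_rat (prob I (edge_set s)) ++ enc_edges s | s <- scs].

Lemma size_costs : size costs = (2 * n)%N.
Proof. by rewrite size_flatten_map /= sum_const_seq size_enum_ord. Qed.

Lemma encode0 : nth 0 w 0 = n. Proof. by []. Qed.
Lemma encode1 : nth 0 w 1 = size es. Proof. by []. Qed.

Lemma encode_blocks :
  w = (n%:Z :: enc_edges es) ++ costs ++
      [:: numq (sigma I); denq (sigma I); numq (lambda I); denq (lambda I);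
          (size scs)%:Z] ++ scenarios.
Proof. by []. Qed.

Lemma encode_cost (v : 'I_n) b : (b < 2)%N ->
  nth 0 w (cost_pos + 2 * v + b) = nth 0 (enc_rat (cost I v)) b.
Proof.
move=> hb; rewrite encode_blocks.
have -> : cost_pos = size (n%:Z :: enc_edges es) by rewrite size_cons size_enc_edges.
rewrite -(addnA (size (n%:Z :: enc_edges es)) (2 * v)%N) nth_cat_add nth_cat size_costs.
have -> : (2 * v + b < 2 * n)%N by have := ltn_ord v; lia.
have := @nth_flatten_map _ _ v 0 (fun v => enc_rat (cost I v)) (enum 'I_n) v b.
rewrite size_enum_ord /= sum_const_seq size_takel ?size_enum_ord ?(ltnW (ltn_ord v)) //.
rewrite nth_ord_enum; by apply.
Qed.

Lemma encode_sigma b : (b < 5)%N ->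
  nth 0 w (sigma_pos + b) =
  nth 0 [:: numq (sigma I); denq (sigma I); numq (lambda I); denq (lambda I);
          (size scs)%:Z] b.
Proof.
move=> hb; rewrite encode_blocks /sigma_pos.
have -> : cost_pos = size (n%:Z :: enc_edges es) by rewrite size_cons size_enc_edges.
by rewrite -size_costs -!addnA nth_cat_add nth_cat_add nth_cat hb.
Qed.

Lemma encode_scenario k j :
  (k < size scs)%N -> (j < 3 + 2 * size (nth [::] scs k))%N ->
  nth 0 w (scenario_pos k + j) =
  nth 0 (enc_rat (prob I (edge_set (nth [::] scs k))) ++ enc_edges (nth [::] scs k)) j.
Proof.
move=> hk hj; rewrite encode_blocks /scenario_pos /sigma_pos.
have -> : cost_pos = size (n%:Z :: enc_edges es) by rewrite size_cons size_enc_edges.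
rewrite -size_costs -!addnA nth_cat_add nth_cat_add.
rewrite (nth_cat_add _ [:: numq (sigma I); _; _; _; _]).
rewrite -(@nth_flatten_map _ _ [::] 0 (fun s =>
   enc_rat (prob I (edge_set s)) ++ enc_edges s)) //.
  by congr (nth _ _ (_ + _)); apply: eq_bigr => s _; rewrite size_cat size_enc_edges.
by rewrite size_cat size_enc_edges.
Qed.

Lemma encode_scenario_edge k j x0 b :
  (k < size scs)%N -> (j < size (nth [::] scs k))%N -> (b < 2)%N ->
  let p := nth x0 (nth [::] scs k) j in
  nth 0 w (scenario_pos k + (3 + 2 * j + b)) =
  nth 0 [:: (val p.1)%:Z; (val p.2)%:Z] b.
Proof.
move=> hk hj hb p; rewrite encode_scenario //; last by lia.
by rewrite -(enc_edges_nth x0 hj hb).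
Qed.

Lemma scenario_posS k : (k < size scs)%N ->
  scenario_pos k.+1 = (scenario_pos k + 3 + 2 * size (nth [::] scs k))%N.
Proof.
by move=> hk; rewrite /scenario_pos (take_nth [::] hk) -cats1 big_cat big_seq1 /=; lia.
Qed.

Lemma size_encode : size w = scenario_pos (size scs).
Proof.
rewrite encode_blocks !size_cat size_costs size_flatten_map /scenario_pos take_size.
rewrite /sigma_pos /cost_pos size_cons size_enc_edges [size [:: _; _; _; _; _]]/=.
rewrite (eq_bigr (fun s : seq ('I_n * 'I_n) => (3 + 2 * size s)%N)); first by lia.
by move=> s _; rewrite size_cat size_enc_edges.
Qed.

(** The case [k = size scs] matters: the position is advanced once more after the last scenario. *)
Lemma scenario_pos_le k : (k <= size scs)%N -> (scenario_pos k <= word_size w)%N.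
Proof.
move=> hk; apply: leq_trans (size_le_word_size _); rewrite size_encode /scenario_pos.
by rewrite leq_add2l take_size -{2}(cat_take_drop k scs) big_cat leq_addr.
Qed.

Lemma vertices_le : (n <= word_size w)%N.
Proof.
have := scenario_pos_le (leq0n _); rewrite /scenario_pos /sigma_pos; lia.
Qed.

Lemma scenarios_le : (size scs <= word_size w)%N.
Proof. exact: size_scenarios. Qed.

Lemma scenario_size_le k : (k < size scs)%N ->
  (size (nth [::] scs k) <= word_size w)%N.
Proof.
move=> hk; have := scenario_pos_le hk; rewrite scenario_posS //; lia.
Qed.

(** Listed in the order in which the program meets them, so that its partial products are products
    of prefixes. *)
Definition dens : seq int :=
  [seq denq (cost I v) | v <- enum 'I_n] ++ [:: denq (sigma I); denq (lambda I)]
  ++ [seq denq (prob I (edge_set s)) | s <- scs].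

Lemma dens_gt0 z : z \in dens -> 0 < z.
Proof.
rewrite !mem_cat => /or3P[/mapP[v _ ->]|/[!inE] /orP[] /eqP->|/mapP[s _ ->]];
  exact: denq_gt0.
Qed.

Lemma word_size_flatten_map (T : Type) (f : T -> seq int) s :
  word_size (flatten (map f s)) = (\sum_(x <- s) word_size (f x))%N.
Proof.
by elim: s => [|x s IH] /=; rewrite ?big_nil /word_size ?big_nil // big_cat big_cons -IH.
Qed.

Lemma word_size_map (T : Type) (f : T -> int) s :
  word_size (map f s) = (\sum_(x <- s) bitlen (f x))%N.
Proof. by rewrite /word_size big_map. Qed.

Lemma word_size_dens : (word_size dens <= word_size w)%N.
Proof.
rewrite encode_blocks /dens !word_size_cat !word_size_map.
rewrite /costs /scenarios !word_size_flatten_map !word_size_cons.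
have ab : (\sum_(v <- enum 'I_n) bitlen (denq (cost I v)) <=
    \sum_(v <- enum 'I_n) word_size (enc_rat (cost I v)))%N.
  by apply: leq_sum => v _; rewrite /enc_rat !word_size_cons; lia.
have cd : (\sum_(s <- scs) bitlen (denq (prob I (edge_set s))) <=
    \sum_(s <- scs) word_size (enc_rat (prob I (edge_set s)) ++ enc_edges s))%N.
  by apply: leq_sum => s _; rewrite /enc_rat word_size_cat !word_size_cons; lia.
apply: leq_trans (leq_add ab (leq_add (leqnn _) cd)) _ => {ab cd}.
move: (\sum_(v <- enum _) _)%N (\sum_(s <- scs) _)%N (word_size [::]) => a b c.
move: (word_size _) => d; lia.
Qed.

End Encoding.

(** * The program *)

(* [aC] and [aQ] hold the positions of the costs and of sigma in the input, [aP]
   that of the current scenario.  [aRem] holds what is left of the reservation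
   budgets, [aR] what is left of the capacities in the current scenario. *)
Local Notation aIn := 0%N (only parsing).
Local Notation aReserved := 1%N (only parsing).
Local Notation aReused := 2%N (only parsing).
Local Notation aBought := 3%N (only parsing).
Local Notation aD := 4%N (only parsing).
Local Notation aI := 5%N (only parsing).
Local Notation aK := 6%N (only parsing).
Local Notation aJ := 7%N (only parsing).
Local Notation aP := 8%N (only parsing).
Local Notation aC := 9%N (only parsing).
Local Notation aOm := 10%N (only parsing).
Local Notation aSg := 11%N (only parsing).
Local Notation aLm := 12%N (only parsing).
Local Notation aPr := 13%N (only parsing).
Local Notation aRem := 14%N (only parsing).
Local Notation aR := 15%N (only parsing).
Local Notation aU := 16%N (only parsing).
Local Notation aV := 17%N (only parsing).
Local Notation aT := 18%N (only parsing).
Local Notation aB := 19%N (only parsing).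
Local Notation aBase := 20%N (only parsing).
Local Notation aCap := 21%N (only parsing).
Local Notation aQ := 22%N (only parsing).

(** Expressions have no conditional, so the 0/1 value of the test serves as a factor. *)
Definition min_expr (x y : expr) : expr := (y + (x - y) * (x <= y))%X.

Definition positions_cmd : cmd :=
  aC ::= #2 + #2 * aIn @ #1;;
  aQ ::= !aC + #2 * aIn @ #0.

Definition next_scenario_cmd : cmd := aP ::= !aP + #3 + #2 * aIn @ (!aP + #2).

Definition denominator_cmd : cmd :=
  aD ::= #1;;
  For aI (aIn @ #0) (aD ::= !aD * aIn @ (!aC + #2 * !aI + #1));;
  aD ::= !aD * aIn @ (!aQ + #1) * aIn @ (!aQ + #3);;
  aP ::= !aQ + #5;;
  For aK (aIn @ (!aQ + #4)) (aD ::= !aD * aIn @ (!aP + #1);; next_scenario_cmd).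

(** The divisions are exact, since [aD] holds a multiple of every denominator. *)
Definition scale_cmd : cmd :=
  aSg ::= !aD * aIn @ (!aQ) / aIn @ (!aQ + #1);;
  aLm ::= !aD * aIn @ (!aQ + #2) / aIn @ (!aQ + #3);;
  For aI (aIn @ #0)
    (aOm @@ (!aI) ::=
       !aD * aIn @ (!aC + #2 * !aI) / aIn @ (!aC + #2 * !aI + #1);;
     aRem @@ (!aI) ::= !aD * !aSg * aOm @ (!aI)).

(** The same code serves before and after the payments, because [aRem] at a vertex changes only once
    the charge there has been computed. *)
Definition bounds_cmd : cmd :=
  aBase ::= !aPr * (!aD - !aSg) * aOm @ (!aI);;
  aCap ::= !aPr * !aLm * aOm @ (!aI);;
  aT ::= !aBase + aRem @ (!aI).

Definition limits_cmd : cmd :=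
  For aI (aIn @ #0) (bounds_cmd;; aR @@ (!aI) ::= min_expr (!aCap) (!aT)).

Definition pay_cmd : cmd :=
  For aJ (aIn @ (!aP + #2))
    (aU ::= aIn @ (!aP + #3 + #2 * !aJ);;
     aV ::= aIn @ (!aP + #3 + #2 * !aJ + #1);;
     aT ::= min_expr (aR @ (!aU)) (aR @ (!aV));;
     aR @@ (!aU) ::= aR @ (!aU) - !aT;;
     aR @@ (!aV) ::= aR @ (!aV) - !aT).

(** The reserved vertices are known only after the last scenario, so the flags written here are
    provisional; [output_cmd] masks them. *)
Definition charge_cmd : cmd :=
  For aI (aIn @ #0)
    (bounds_cmd;;
     aB ::= min_expr (!aCap) (!aT) - aR @ (!aI);;
     aReused @@ (!aK * aIn @ #0 + !aI) ::= !aBase <= !aB;;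
     aBought @@ (!aK * aIn @ #0 + !aI) ::= !aB == !aCap;;
     aRem @@ (!aI) ::= aRem @ (!aI) - (!aB - !aBase) * (!aBase <= !aB)).

Definition scenarios_cmd : cmd :=
  aP ::= !aQ + #5;;
  For aK (aIn @ (!aQ + #4))
    (aPr ::= !aD * aIn @ (!aP) / aIn @ (!aP + #1);;
     limits_cmd;; pay_cmd;; charge_cmd;; next_scenario_cmd).

Definition output_cmd : cmd :=
  For aI (aIn @ #0)
    (aReserved @@ (!aI) ::= aRem @ (!aI) == #0;;
     For aK (aIn @ (!aQ + #4))
       (aReused @@ (!aK * aIn @ #0 + !aI) ::=
          aReused @ (!aK * aIn @ #0 + !aI) * aReserved @ (!aI);;
        aBought @@ (!aK * aIn @ #0 + !aI) ::=
          aBought @ (!aK * aIn @ #0 + !aI) * (#1 - aReserved @ (!aI)))).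

Definition program : cmd :=
  positions_cmd;; denominator_cmd;; scale_cmd;; scenarios_cmd;; output_cmd.

(** * Correctness and running time of the program *)

Section Correctness.

Variables (n : nat) (I : instance 'I_n).
Variables (es : seq ('I_n * 'I_n)) (scs : seq (seq ('I_n * 'I_n))).

Let w := encode I es scs.
Let W := word_size w.
(* The scaled data are at most [2 ^ (2 W)], all the other cells at most four
   times a product of three of them. *)
Let l := (6 * W + 2)%N.
Let K := size scs.

Definition common_den : int := \prod_(z <- dens I scs) z.
Let D := common_den.

Definition scaled (q : rat) : int := (D * numq q %/ denq q)%Z.

Let om v := scaled (cost I v).
Let sg := scaled (sigma I).
Let lm := scaled (lambda I).
Let pr k := scaled (prob I (edge_set (nth [::] scs k))).

Let scen k := nth [::] scs k.

(** Each of the three quantities is a product of three scaled factors, hence [D ^+ 3] times the true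
    value; in [rem_of] the factor [D] stands where the others have a probability. *)
Definition base_of k (v : 'I_n) : int := pr k * (D - sg) * om v.
Definition cap_of k (v : 'I_n) : int := pr k * lm * om v.
Definition rem_of (v : 'I_n) : int := D * sg * om v.

Hypothesis scaled_bounds :
  [/\ forall v, 0 <= om v, 0 <= sg <= D, D <= lm & forall k, 0 <= pr k].
Hypothesis scen_neq : forall k, {in scen k, forall p : 'I_n * 'I_n, p.1 != p.2}.

Local Notation wp := (wp W l).

Definition inputs (m : memory) : Prop :=
  [/\ forall x, m aIn x = load w aIn x, m aC 0 = cost_pos es
    & m aQ 0 = sigma_pos es].

Lemma inputsE m x j : inputs m -> x = Posz j -> m aIn x = nth 0 w j.
Proof. by case=> h _ _ ->; rewrite h. Qed.

Lemma inputs_agree s m m' : agree_off s m m' -> all (predC (mem s)) [:: aIn; aC; aQ] ->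
  inputs m -> inputs m'.
Proof.
move=> h /and4P[/= h1 h2 h3 _] [i1 i2 i3].
by split=> [x||]; rewrite h // ?i1.
Qed.

Lemma inputs_n m : inputs m -> m aIn 0 = n.
Proof. by move=> h; rewrite (inputsE (j := 0) h). Qed.

Lemma inputs_K m : inputs m -> m aIn (m aQ 0 + 4) = K.
Proof.
move=> h; rewrite (inputsE (j := sigma_pos es + 4) h) ?encode_sigma //.
by case: h => _ _ ->; lia.
Qed.

Let W_le : (W <= 2 ^ l)%N.
Proof.
apply: (@leq_trans (2 ^ W)%N); first by rewrite ltnW // ltn_expl.
by rewrite leq_exp2l // /l; lia.
Qed.
Let l_gt0 : (0 < l)%N. Proof. by rewrite /l addn_gt0 orbT. Qed.

Let wp_assign a i e m Q := @wp_set W l W_le l_gt0 a i e m Q.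

Lemma common_den_gt0 : 0 < D.
Proof.
have /andP[] := @prod_le_word_size (dens I scs) (size (dens I scs)) (@dens_gt0 _ I scs).
by rewrite take_size.
Qed.

Lemma partial_den_le i : 0 < \prod_(z <- take i (dens I scs)) z <= 2 ^+ W.
Proof.
have /andP[h1 h2] := @prod_le_word_size (dens I scs) i (@dens_gt0 _ I scs).
rewrite h1 (le_trans h2) // ler_weXn2l //; exact: word_size_dens.
Qed.

Lemma pow2E k : (2 ^ k)%N%:Z = 2 ^+ k.
Proof. by rewrite -natz natrX. Qed.

Lemma pow_le_cell (z : int) : `|z| <= 2 ^+ W -> (`|z| <= 2 ^ l)%N.
Proof.
move=> h; rewrite -lez_nat pow2E abszE (le_trans h) // ler_weXn2l // /l; lia.
Qed.

Lemma wp_for_vertices i c m0 (Inv : nat -> memory -> Prop) (Q : memory -> Prop) :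
  i \notin writes c -> all (predC (mem (i :: writes c))) [:: aIn; aC; aQ] ->
  inputs m0 ->
  Inv 0%N (update m0 i 0 0) ->
  (forall (v : 'I_n) m, agree_off (i :: writes c) m0 m -> inputs m ->
     m i 0 = val v -> Inv v m ->
     wp c m (fun m' => m' i 0 = val v -> Inv v.+1 (update m' i 0 v.+1))) ->
  (forall m, agree_off (i :: writes c) m0 m -> inputs m -> Inv n m -> Q m) ->
  wp (For i (aIn @ #0) c) m0 Q.
Proof.
move=> h1 h2 h3 h4 h5 h6.
apply: (wp_for W_le l_gt0 (n := n) (Inv := Inv)) => //.
- by case/andP: h2 => /= ->.
- exact: vertices_le.
- by rewrite /= (inputs_n h3).
- move=> k m kn ag mi Im; exact: (h5 (Ordinal kn) m ag (inputs_agree ag h2 h3) mi).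
- by move=> m ag; apply: h6 => //; apply: inputs_agree ag h2 h3.
Qed.

Lemma wp_for_scenarios i c m0 (Inv : nat -> memory -> Prop) (Q : memory -> Prop) :
  i \notin writes c -> all (predC (mem (i :: writes c))) [:: aIn; aC; aQ] ->
  inputs m0 ->
  Inv 0%N (update m0 i 0 0) ->
  (forall k m, (k < K)%N -> agree_off (i :: writes c) m0 m -> inputs m ->
     m i 0 = k -> Inv k m ->
     wp c m (fun m' => m' i 0 = k -> Inv k.+1 (update m' i 0 k.+1))) ->
  (forall m, agree_off (i :: writes c) m0 m -> inputs m -> Inv K m -> Q m) ->
  wp (For i (aIn @ (!aQ + #4)) c) m0 Q.
Proof.
move=> h1 h2 h3 h4 h5 h6.
apply: (wp_for W_le l_gt0 (n := K) (Inv := Inv)) => //.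
- by case/and4P: h2 => /= -> _ ->.
- exact: scenarios_le.
- by rewrite /= (inputs_K h3).
- move=> k m kn ag mi Im; exact: (h5 k m kn ag (inputs_agree ag h2 h3) mi).
- by move=> m ag; apply: h6 => //; apply: inputs_agree ag h2 h3.
Qed.

Lemma wp_positions m : (forall x, m aIn x = load w aIn x) ->
  wp positions_cmd m inputs.
Proof.
move=> h; have le_pos : (sigma_pos es <= 2 ^ l)%N.
  apply: leq_trans (leq_trans (scenario_pos_le I es (leq0n K)) W_le).
  by rewrite /scenario_pos; lia.
have e1 : 2 + 2 * m aIn 1 = cost_pos es.
  by rewrite h (loadE w 1) encode1 /cost_pos; lia.
have e2 : (cost_pos es)%:Z + 2 * m aIn 0 = sigma_pos es.
  by rewrite h (loadE w 0) encode0 /sigma_pos; lia.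
apply: wp_seq; apply: wp_assign => //.
  by move=> _; rewrite /= e1 /=; apply: leq_trans le_pos; rewrite /sigma_pos; lia.
rewrite /= e1; apply: wp_assign => //; first by move=> _; rewrite /= /update /= e2.
Qed.

Lemma nth_dens_cost (v : 'I_n) : nth 0 (dens I scs) v = denq (cost I v).
Proof.
rewrite /dens nth_cat size_map size_enum_ord ltn_ord (nth_map v) ?size_enum_ord //.
by rewrite nth_ord_enum.
Qed.

Lemma prod_take_nth (s : seq int) i : (i < size s)%N ->
  \prod_(z <- take i.+1 s) z = \prod_(z <- take i s) z * nth 0 s i.
Proof. by move=> h; rewrite (take_nth 0 h) -cats1 big_cat big_seq1. Qed.

Lemma size_dens : size (dens I scs) = (n + 2 + K)%N.
Proof. by rewrite !size_cat size_map size_enum_ord size_map /= addnA. Qed.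

Lemma next_scenarioE k m : (k < K)%N -> inputs m -> m aP 0 = scenario_pos es scs k ->
  eval m (!aP + #3 + #2 * aIn @ (!aP + #2)) = scenario_pos es scs k.+1.
Proof.
move=> hk hi hp; rewrite scenario_posS //=.
rewrite (inputsE (j := scenario_pos es scs k + 2) hi) ?encode_scenario //; last by lia.
rewrite hp /= ; lia.
Qed.

Lemma scenario_pos_bound k : (k <= K)%N -> (scenario_pos es scs k <= 2 ^ l)%N.
Proof. move=> h; exact: leq_trans (scenario_pos_le I es h) W_le. Qed.

Lemma first_scenarioE m : inputs m ->
  eval m (!aQ + #5) = scenario_pos es scs 0.
Proof. by case=> _ _ /= ->; rewrite /scenario_pos take0 big_nil; lia. Qed.

Lemma wp_denominator m0 : inputs m0 -> wp denominator_cmd m0 (fun m => m aD 0 = D).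
Proof.
(* The values taken by [aD] are products of prefixes of [dens]. *)
move=> h0; pose part i := \prod_(z <- take i (dens I scs)) z.
have part_le i : (`|part i| <= 2 ^ l)%N.
  by have /andP[h1 h2] := partial_den_le i; apply: pow_le_cell; rewrite gtr0_norm.
apply: wp_seq; apply: wp_assign => [_ /=|]; first by rewrite expn_gt0.
set m1 := update _ _ _ _; have {h0} h1 : inputs m1 by [].
apply: wp_seq; apply: (wp_for_vertices (Inv := fun k m => m aD 0 = part k)) => //.
- by rewrite /m1 /part take0 big_nil.
- move=> v m ag hi mi hD.
  have E : eval m (!aD * aIn @ (!aC + #2 * !aI + #1)) = part v.+1.
    rewrite /= (inputsE (j := cost_pos es + 2 * v + 1) hi); last first.
      by case: hi => _ -> _; rewrite mi /=; lia.
    rewrite encode_cost // /part prod_take_nth ?nth_dens_cost ?hD //.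
    by rewrite size_dens; have := ltn_ord v; lia.
  by apply: wp_assign; rewrite ?E.
move=> {h1} m2 _ h2 hD2; 
apply: wp_seq.
have E : eval m2 (!aD * aIn @ (!aQ + #1) * aIn @ (!aQ + #3)) = part (n + 2)%N.
  rewrite /= (inputsE (j := sigma_pos es + 1) h2); last by case: h2 => _ _ ->; lia.
  rewrite (inputsE (j := sigma_pos es + 3) h2); last by case: h2 => _ _ ->; lia.
  rewrite !encode_sigma //= hD2 /part addn2 !prod_take_nth ?size_dens; try lia.
  rewrite /dens !nth_cat size_map size_enum_ord ltnn subnn /=.
  by rewrite ltnNge leqnSn /= subSnn.
apply: wp_assign; rewrite E // => {E}.
set m3 := update _ _ _ _; have {h2} h3 : inputs m3 by [].
have E5 := first_scenarioE h3.
apply: wp_seq; apply: wp_assign => [_|]; rewrite E5; first exact: scenario_pos_bound.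
set m4 := update _ _ _ _; have {h3} h4 : inputs m4 by [].
(* The offset [n + 2] skips the denominators of the costs, of sigma and of lambda. *)
apply: (wp_for_scenarios (Inv := fun k m =>
  m aD 0 = part (n + 2 + k)%N /\ m aP 0 = scenario_pos es scs k)) => //.
- by rewrite addn0.
- move=> k m hk _ hi mk [hD hP]; apply: wp_seq.
  have E : eval m (!aD * aIn @ (!aP + #1)) = part (n + 2 + k.+1)%N.
    rewrite /= (inputsE (j := scenario_pos es scs k + 1) hi); last by rewrite hP; lia.
    rewrite encode_scenario // hD [(n + 2 + k.+1)%N]addnS /part prod_take_nth; last first.
      by rewrite size_dens ltn_add2l.
    congr (_ * _); rewrite [LHS]/= /dens catA nth_cat size_cat size_map size_enum_ord.
    rewrite ltnNge leq_addr /= addKn (nth_map [::]) //.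
  apply: wp_assign; rewrite E //.
  set m' := update _ _ _ _; have {}hi : inputs m' by [].
  have E' := next_scenarioE hk hi (hP : m' aP 0 = _).
  apply: wp_assign => [_|]; rewrite E'; first exact: scenario_pos_bound.
  by move=> _; split.
- move=> m _ hi [-> _]; rewrite /part take_oversize // size_dens; lia.
Qed.

(** * Size of the scaled data *)

Let X : int := 2 ^+ (2 * W).

Lemma cell_le (z : int) : - (4 * X ^+ 3) <= z <= 4 * X ^+ 3 -> (`|z| <= 2 ^ l)%N.
Proof.
move=> h; rewrite -lez_nat pow2E abszE ler_norml.
have -> : l = (2 * W * 3 + 2)%N by rewrite /l; lia.
by rewrite exprD exprM -/X mulrC (_ : 2 ^+ 2 = 4 :> int).
Qed.

(** Both [D] and the numerator, an entry of the input, are at most [2 ^ W], and dividing does not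
    increase their product. *)
Lemma scaled_le_X q j : numq q = nth 0 w j -> 0 <= numq q -> 0 <= scaled q <= X.
Proof.
move=> hq q0; rewrite /scaled /X mul2n -addnn exprD.
have h1 : D <= 2 ^+ W.
  by have /andP[_] := partial_den_le (size (dens I scs)); rewrite take_size.
have h2 : numq q <= 2 ^+ W.
  by rewrite -(ger0_norm q0) hq -abszE -pow2E lez_nat nth_le_word_size.
have h3 := denq_gt0 q; have h4 := common_den_gt0.
have h5 : 0 <= D * numq q <= 2 ^+ W * 2 ^+ W by nia.
have h6 := lez_div (D * numq q) (denq q).
have h7 : 0 <= (D * numq q %/ denq q)%Z by rewrite divz_ge0 //; case/andP: h5.
lia.
Qed.

Hypothesis num_ge0 : [/\ forall v, 0 <= numq (cost I v), 0 <= numq (sigma I),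
  0 <= numq (lambda I) & forall k, 0 <= numq (prob I (edge_set (scen k)))].

Lemma cost_bounds v : 0 <= om v <= X.
Proof.
case: num_ge0 => h _ _ _; apply: (scaled_le_X (j := cost_pos es + 2 * v + 0)) => //.
by rewrite encode_cost.
Qed.

Lemma sigma_lambda_bounds : 0 <= sg <= D /\ D <= lm <= X.
Proof.
case: num_ge0 => _ _ h _; case: scaled_bounds => _ h1 h2 _; split=> //.
have E : numq (lambda I) = nth 0 w (sigma_pos es + 2) by rewrite encode_sigma.
by rewrite h2; have /andP[] := scaled_le_X E h.
Qed.

(** Beyond [K] the default scenario is empty, and its probability need not occur in the input. *)
Lemma prob_bounds k : (k < K)%N -> 0 <= pr k <= X.
Proof.
move=> hk; case: num_ge0 => _ _ _ h.
apply: (scaled_le_X (j := scenario_pos es scs k + 0)) => //.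
by rewrite encode_scenario.
Qed.

Lemma base_of_bounds k v : 0 <= base_of k v <= cap_of k v.
Proof.
case: scaled_bounds => h1 h2 h3 h4; have := h1 v; have := h4 k => a b.
have : 0 <= pr k * (D - sg) <= pr k * lm by nia.
by rewrite /base_of /cap_of; nia.
Qed.

Lemma cap_of_le k v : (k < K)%N -> cap_of k v <= X ^+ 3.
Proof.
move=> hk; have h1 := cost_bounds v; have h2 := prob_bounds hk.
have [h3 h4] := sigma_lambda_bounds; rewrite /cap_of !exprSr expr0 mul1r.
have h5 : 0 <= pr k * lm <= X * X by nia.
nia.
Qed.

Lemma rem_of_bounds v : 0 <= rem_of v <= X ^+ 3.
Proof.
have h1 := cost_bounds v; have [h3 h4] := sigma_lambda_bounds.
rewrite /rem_of !exprSr expr0 mul1r.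
have h5 : 0 <= D * sg <= X * X by nia.
nia.
Qed.

Let rem := remaining scen cap_of base_of rem_of.
Let lim k := limit cap_of base_of (rem k) k.
Let chg := charge scen cap_of base_of rem_of.

Lemma rem_bounds k v : 0 <= rem k v <= X ^+ 3.
Proof.
have h1 k' u := proj1 (andP (base_of_bounds k' u)).
have h2 k' u := proj2 (andP (base_of_bounds k' u)).
have h3 u := proj1 (andP (rem_of_bounds u)).
apply/andP; split; first exact: remaining_ge0.
apply: le_trans (remaining_anti _ _ _ _ v (leq0n k)) _.
by case/andP: (rem_of_bounds v).
Qed.

Lemma lim_bounds k v : (k < K)%N -> 0 <= lim k v <= X ^+ 3.
Proof.
move=> hk; have := rem_bounds k v; have := base_of_bounds k v.
by have := cap_of_le v hk; rewrite /lim /limit; lia.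
Qed.

Lemma chg_bounds k v : 0 <= chg k v <= lim k v.
Proof.
have h1 k' u := proj1 (andP (base_of_bounds k' u)).
have h2 k' u := proj2 (andP (base_of_bounds k' u)).
have h3 u := proj1 (andP (rem_of_bounds u)).
exact: charge_bounds.
Qed.

(** * The phases of the program *)

Definition env (m : memory) : Prop :=
  [/\ inputs m, m aD 0 = D, m aSg 0 = sg, m aLm 0 = lm
    & forall v : 'I_n, m aOm v = om v].

Lemma env_agree s m m' : agree_off s m m' ->
  all (predC (mem s)) [:: aIn; aC; aQ; aD; aSg; aLm; aOm] -> env m -> env m'.
Proof.
move=> h hs [h1 h2 h3 h4 h5]; move: hs.
rewrite /= => /and4P[a1 a2 a3 /and5P[a4 a5 a6 a7 _]].
split; [|by rewrite h..|by move=> v; rewrite h //].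
by apply: (inputs_agree h) h1; rewrite /= a1 a2 a3.
Qed.

Lemma min_exprE m x y : eval m (min_expr x y) = Num.min (eval m x) (eval m y).
Proof. by rewrite /=; lia. Qed.

Lemma wp_scale m0 : inputs m0 -> m0 aD 0 = D ->
  wp scale_cmd m0 (fun m => env m /\ forall v : 'I_n, m aRem v = rem_of v).
Proof.
move=> h0 hD.
have X0 : 0 <= X ^+ 3 by rewrite exprn_ge0 // exprn_ge0.
have X1 : X <= X ^+ 3.
  by rewrite -[leLHS]expr1 ler_weXn2l // /X exprn_ege1.
have E1 : eval m0 (!aD * aIn @ (!aQ) / aIn @ (!aQ + #1)) = sg.
  rewrite /= (inputsE (j := sigma_pos es + 0) h0); last by case: h0 => _ _ ->; lia.
  rewrite (inputsE (j := sigma_pos es + 1) h0); last by case: h0 => _ _ ->; lia.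
  by rewrite !encode_sigma // hD.
have [sg_b lm_b] := sigma_lambda_bounds.
apply: wp_seq; apply: wp_assign => [_|]; rewrite E1; first by apply: cell_le; lia.
set m1 := update _ _ _ _; have {h0} h1 : inputs m1 by [].
have E2 : eval m1 (!aD * aIn @ (!aQ + #2) / aIn @ (!aQ + #3)) = lm.
  rewrite /= (inputsE (j := sigma_pos es + 2) h1); last by case: h1 => _ _ ->; lia.
  rewrite (inputsE (j := sigma_pos es + 3) h1); last by case: h1 => _ _ ->; lia.
  by rewrite !encode_sigma // (hD : m1 aD 0 = D).
apply: wp_seq; apply: wp_assign => [_|]; rewrite E2; first by apply: cell_le; lia.
set m2 := update _ _ _ _; have {h1} h2 : inputs m2 by [].
apply: (wp_for_vertices (Inv := fun k m => forall v : 'I_n, (v < k)%N ->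
  m aOm v = om v /\ m aRem v = rem_of v)) => //.
- move=> v m ag hi mi IH.
  have hD' : m aD 0 = D by rewrite ag.
  have hS' : m aSg 0 = sg by rewrite ag.
  have E3 : eval m (!aD * aIn @ (!aC + #2 * !aI) / aIn @ (!aC + #2 * !aI + #1)) = om v.
    have hc : m aC 0 = cost_pos es by case: hi.
    rewrite /= (inputsE (j := cost_pos es + 2 * v + 0) hi); last by rewrite hc mi /=; lia.
    rewrite (inputsE (j := cost_pos es + 2 * v + 1) hi); last by rewrite hc mi /=; lia.
    by rewrite !encode_cost // hD'.
  have := cost_bounds v => hv.
  apply: wp_seq; apply: wp_assign => [_|]; rewrite E3; first by apply: cell_le; lia.
  rewrite [eval _ _]mi; set m3 := update _ _ _ _.
  have E4 : eval m3 (!aD * !aSg * aOm @ (!aI)) = rem_of v.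
    by rewrite /= /m3 /update /= hD' hS' mi eqxx.
  have := rem_of_bounds v => hr.
  apply: wp_assign => [_|]; rewrite E4; first by apply: cell_le; lia.
  rewrite [eval _ _]mi => _ u hu; rewrite /m3 /update /= !eqz_nat.
  have [/ord_inj ->|ne] := eqVneq (u : nat) v; first by [].
  by apply: IH; rewrite ltn_neqAle ne -ltnS.
- move=> m ag hi IH; split; last by move=> v; case: (IH v (ltn_ord v)).
  split=> //; [by rewrite ag..|by move=> v; case: (IH v (ltn_ord v))].
Qed.

Lemma wp_bounds k (v : 'I_n) m (Q : memory -> Prop) :
  (k < K)%N -> env m -> m aPr 0 = pr k -> m aI 0 = val v ->
  0 <= m aRem v <= X ^+ 3 ->
  (forall m', agree_off [:: aBase; aCap; aT] m m' -> m' aBase 0 = base_of k v ->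
     m' aCap 0 = cap_of k v -> m' aT 0 = base_of k v + m aRem v -> Q m') ->
  wp bounds_cmd m Q.
Proof.
move=> hk [hi hD hS hL hO] hP mi hr HQ.
have hb := base_of_bounds k v; have hc := cap_of_le v hk.
apply: wp_seq; apply: wp_assign.
all: rewrite [eval _ (_ * _)%X]/= hP hD hS mi hO -/(base_of k v).
  by move=> _; apply: cell_le; lia.
set m1 := update _ _ _ _.
have E1 : eval m1 (!aPr * !aLm * aOm @ (!aI)) = cap_of k v.
  by rewrite /m1 /update /= hP hL mi hO.
apply: wp_seq; apply: wp_assign => [_|]; rewrite E1; first by apply: cell_le; lia.
set m2 := update _ _ _ _.
have E2 : eval m2 (!aBase + aRem @ (!aI)) = base_of k v + m aRem v.
  by rewrite /m2 /m1 /update /= mi.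
apply: wp_assign => [_|]; rewrite E2; first by apply: cell_le; lia.
apply: HQ => //; rewrite /m2 /m1 => a j.
by rewrite /update !inE !negb_or => /and3P[/negPf -> /negPf -> /negPf ->].
Qed.

Lemma wp_limits k m0 : (k < K)%N -> env m0 -> m0 aPr 0 = pr k ->
  (forall v : 'I_n, m0 aRem v = rem k v) ->
  wp limits_cmd m0 (fun m => forall v : 'I_n, m aR v = lim k v).
Proof.
move=> hk he hP hR; apply: (wp_for_vertices (Inv := fun i m =>
  forall v : 'I_n, (v < i)%N -> m aR v = lim k v)) => //; first by case: he.
- move=> v m ag hi mi IH.
  have he' : env m by apply: env_agree ag _ he.
  have rv : m aRem v = rem k v by rewrite ag.
  apply: wp_seq; apply: (wp_bounds (k := k) (v := v)) => //.
  + by rewrite ag.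
  + by rewrite rv rem_bounds.
  move=> m1 ag1 hb hc ht.
  have E : eval m1 (min_expr (!aCap) (!aT)) = lim k v.
    by rewrite min_exprE [eval _ _]hc [eval _ _]ht rv.
  have hl := lim_bounds v hk.
  apply: wp_assign => [_|]; rewrite E; first by apply: cell_le; lia.
  have -> : eval m1 (!aI) = v by rewrite /= ag1.
  move=> _ u hu; rewrite /update /= !eqz_nat.
  have [/ord_inj ->|ne] := eqVneq (u : nat) v; first by [].
  by rewrite ag1 //; apply: IH; rewrite ltn_neqAle ne -ltnS.
- by move=> m _ _ IH v; apply: IH.
Qed.

Lemma residual_take_bounds k j v : (k < K)%N ->
  0 <= residual (lim k) (take j (scen k)) v <= X ^+ 3.
Proof.
move=> hk; have h u : 0 <= lim k u by case/andP: (lim_bounds u hk).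
have := residual_bounds (take j (scen k)) h v; have := lim_bounds v hk; lia.
Qed.

Lemma wp_pay k m0 : (k < K)%N -> env m0 -> m0 aP 0 = scenario_pos es scs k ->
  (forall v : 'I_n, m0 aR v = lim k v) ->
  wp pay_cmd m0 (fun m => forall v : 'I_n, m aR v = residual (lim k) (scen k) v).
Proof.
move=> hk he hP hR; set N := size (scen k).
have n_le : (n <= 2 ^ l)%N by apply: leq_trans W_le; apply: vertices_le.
apply: (wp_for W_le l_gt0 (n := N) (Inv := fun j m => forall v : 'I_n,
  m aR v = residual (lim k) (take j (scen k)) v)) => //.
- exact: scenario_size_le.
- case: he => hi _ _ _ _; rewrite /= (inputsE (j := scenario_pos es scs k + 2) hi).
    by rewrite encode_scenario.
  by rewrite hP; lia.
- by move=> v; rewrite take0; apply: hR.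
- move=> j m hj ag mj IH.
  have he' : env m by apply: env_agree ag _ he.
  have hi : inputs m by case: he'.
  have hP' : m aP 0 = scenario_pos es scs k by rewrite ag.
  (* A default edge for [nth]; it is taken from the scenario itself, as ['I_n] could be empty. *)
  have [x0 _] : exists x0 : 'I_n * 'I_n, x0 \in scen k.
    by move: hj; rewrite /N; case: (scen k) => // x ? _; exists x; rewrite mem_head.
  set r := residual _ _ in IH; set p := nth x0 (scen k) j.
  have E1 : eval m (aIn @ (!aP + #3 + #2 * !aJ)) = val p.1.
    rewrite /= (inputsE (j := scenario_pos es scs k + (3 + 2 * j + 0)) hi).
      by rewrite (encode_scenario_edge I es x0).
    by rewrite hP' mj; lia.
  apply: wp_seq; apply: wp_assign => [_|]; rewrite E1.
    by apply: leq_trans n_le; rewrite ltnW // ltn_ord.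
  set m1 := update _ _ _ _.
  have E2 : eval m1 (aIn @ (!aP + #3 + #2 * !aJ + #1)) = val p.2.
    rewrite /= (inputsE (m := m1) (j := scenario_pos es scs k + (3 + 2 * j + 1))) //.
      by rewrite (encode_scenario_edge I es x0).
    by rewrite /m1 /update /= hP' mj; lia.
  apply: wp_seq; apply: wp_assign => [_|]; rewrite E2.
    by apply: leq_trans n_le; rewrite ltnW // ltn_ord.
  set m2 := update _ _ _ _.
  have E3 : eval m2 (min_expr (aR @ (!aU)) (aR @ (!aV))) = Num.min (r p.1) (r p.2).
    by rewrite min_exprE /m2 /m1 /update /= !IH.
  have hr v := residual_take_bounds j v hk; rewrite -/r in hr.
  have h1 := hr p.1; have h2 := hr p.2.
  apply: wp_seq; apply: wp_assign => [_|]; rewrite E3; first by apply: cell_le; lia.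
  set t := Num.min _ _ in E3 *; set m3 := update _ _ _ _.
  (* The two updates hit different cells, so the second one still reads the old residual of
     [p.2]. *)
  have ne : p.1 != p.2 by apply: (@scen_neq k); rewrite mem_nth.
  have E4 : eval m3 (aR @ (!aU) - !aT) = r p.1 - t.
    by rewrite /m3 /m2 /m1 /update /= IH.
  have ht : 0 <= t <= r p.1 /\ t <= r p.2 by rewrite /t; lia.
  apply: wp_seq; apply: wp_assign => [_|]; rewrite E4; first by apply: cell_le; lia.
  rewrite (_ : eval m3 (!aU) = val p.1) //; set m4 := update _ _ _ _.
  have E5 : eval m4 (aR @ (!aV) - !aT) = r p.2 - t.
    rewrite /m4 /m3 /m2 /m1 /update /= eqz_nat.
    by rewrite [_ == _ :> nat](_ : _ = false) ?IH //; apply/negbTE; rewrite eq_sym.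
  apply: wp_assign => [_|]; rewrite E5; first by apply: cell_le; lia.
  rewrite (_ : eval m4 (!aV) = val p.2) //.
  move=> _ v; rewrite (take_nth x0 hj) -/p -cats1.
  rewrite /residual foldl_cat /= -/(residual _ _) -/r.
  rewrite /pay -/t /m4 /m3 /m2 /m1 /update /= !eqz_nat.
  rewrite -[(v : nat) == p.1]/(v == p.1) -[(v : nat) == p.2]/(v == p.2).
  case: (eqVneq v p.2) => [->|n2]; first by rewrite orbT mulr1.
  case: (eqVneq v p.1) => [->|n1]; first by rewrite mulr1.
  by rewrite IH mulr0 subr0.
- by move=> m _ IH v; rewrite IH take_size.
Qed.

(** Uniqueness of quotient and remainder modulo [n]: distinct scenario-vertex pairs never share a
    cell. *)
Lemma cell_inj k k' (u v : 'I_n) :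
  (k' * n + u == k * n + v)%N = (k' == k) && (u == v).
Proof.
apply/eqP/andP => [h|[/eqP-> /eqP->] //].
have hu := ltn_ord u; have hv := ltn_ord v.
have hk : k' = k by nia.
by split; [apply/eqP | apply/eqP/ord_inj; move: h; rewrite hk => /addnI].
Qed.

(** The last clause is stated because all scenarios share the two flag arrays, so the frame
    condition does not protect the earlier rows. *)
Lemma wp_charge k m0 : (k < K)%N -> env m0 -> m0 aPr 0 = pr k -> m0 aK 0 = k ->
  (forall v : 'I_n, m0 aRem v = rem k v) ->
  (forall v : 'I_n, m0 aR v = residual (lim k) (scen k) v) ->
  wp charge_cmd m0 (fun m =>
    [/\ forall v : 'I_n, m aRem v = rem k.+1 v,
        forall v : 'I_n, m aReused (k * n + v)%N = (base_of k v <= chg k v),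
        forall v : 'I_n, m aBought (k * n + v)%N = (chg k v == cap_of k v)
      & forall k' (v : 'I_n), (k' < k)%N ->
          m aReused (k' * n + v)%N = m0 aReused (k' * n + v)%N /\
          m aBought (k' * n + v)%N = m0 aBought (k' * n + v)%N]).
Proof.
move=> hk he hP hK hR hL.
(* Vertices below [i] already have the budget left after scenario [k]; the others still have the one
   that entered its limits. *)
apply: (wp_for_vertices (Inv := fun i m =>
  [/\ forall v : 'I_n, m aRem v = rem (if (v < i)%N then k.+1 else k) v,
      forall v : 'I_n, (v < i)%N -> m aReused (k * n + v)%N = (base_of k v <= chg k v),
      forall v : 'I_n, (v < i)%N -> m aBought (k * n + v)%N = (chg k v == cap_of k v)
    & forall k' (v : 'I_n), (k' < k)%N ->
        m aReused (k' * n + v)%N = m0 aReused (k' * n + v)%N /\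
        m aBought (k' * n + v)%N = m0 aBought (k' * n + v)%N])) => //.
- by case: he.
- move=> v m ag hi mi [I1 I2 I3 I4].
  have he' : env m by apply: env_agree ag _ he.
  have rv : m aRem v = rem k v by rewrite I1 ltnn.
  apply: wp_seq; apply: (wp_bounds (k := k) (v := v)) => //.
  + by rewrite ag.
  + by rewrite rv rem_bounds.
  move=> m1 ag1 hb hc ht.
  have mK : m1 aK 0 = k by rewrite ag1 // ag.
  have m1i : m1 aI 0 = v by rewrite ag1.
  have m1n : m1 aIn 0 = n by rewrite ag1 // (inputs_n hi).
  have E1 : eval m1 (min_expr (!aCap) (!aT) - aR @ (!aI)) = chg k v.
    rewrite -[LHS]/(eval m1 (min_expr (!aCap) (!aT)) - m1 aR (m1 aI 0)) min_exprE.
    by rewrite [eval _ _]hc [eval _ _]ht rv m1i ag1 // ag // hL.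
  have hl := lim_bounds v hk; have hch := chg_bounds k v.
  have hbs := base_of_bounds k v; have hrm := rem_bounds k.+1 v.
  have X3 : 1 <= X ^+ 3 by rewrite !exprn_ege1.
  apply: wp_seq; apply: wp_assign => [_|]; rewrite E1; first by apply: cell_le; lia.
  set m2 := update _ _ _ _.
  have Ei (m' : memory) : m' aK 0 = k -> m' aIn 0 = n -> m' aI 0 = v ->
      eval m' (!aK * aIn @ #0 + !aI) = (k * n + v)%N.
    by move=> /= -> -> ->; lia.
  have E2 : eval m2 (!aBase <= !aB) = (base_of k v <= chg k v).
    by rewrite /m2 /update /= hb.
  apply: wp_seq; apply: wp_assign => [_|]; rewrite E2.
    by apply: cell_le; case: (_ <= _ :> int) => /=; lia.
  rewrite (Ei m2) //; set m3 := update _ _ _ _.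
  have E3 : eval m3 (!aB == !aCap) = (chg k v == cap_of k v).
    by rewrite /m3 /m2 /update /= hc.
  apply: wp_seq; apply: wp_assign => [_|]; rewrite E3.
    by apply: cell_le; case: (_ == _ :> int) => /=; lia.
  rewrite (Ei m3) //; set m4 := update _ _ _ _.
  have E4 : eval m4 (aRem @ (!aI) - (!aB - !aBase) * (!aBase <= !aB)) = rem k.+1 v.
    rewrite /m4 /m3 /m2 /update /= m1i hb ag1 // rv /rem /= -/rem -/(chg k).
    by rewrite -[charge_from _ _ _ _ _ _]/(chg k v); lia.
  apply: wp_assign => [_|]; rewrite E4; first by apply: cell_le; lia.
  rewrite [eval _ _](_ : _ = v%:Z) // => _.
  rewrite /m4 /m3 /m2; split=> [u|u hu|u hu|k' u hk'] /=;
    rewrite /update /= ?eqz_nat ?cell_inj ?eqxx /=.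
  + rewrite -[(u : nat) == v]/(u == v) ltnS leq_eqVlt.
    rewrite -[(u : nat) == v]/(u == v); case: eqVneq => [-> //|ne] /=.
    by rewrite ag1.
  + case: eqVneq => [-> //|ne]; rewrite ag1 // I2 //.
    by rewrite ltn_neqAle -ltnS hu andbT.
  + case: eqVneq => [-> //|ne]; rewrite ag1 // I3 //.
    by rewrite ltn_neqAle -ltnS hu andbT.
  + by rewrite (ltn_eqF hk') /= !ag1 //; apply: I4.
- move=> m _ _ [I1 I2 I3 I4]; split=> // v; [rewrite I1 ltn_ord //|exact: I2|exact: I3].
Qed.

(** The provisional flags, before masking by the reserved set. *)
Let flags_ok (m : memory) := forall k (v : 'I_n), (k < K)%N ->
  m aReused (k * n + v)%N = (base_of k v <= chg k v) /\
  m aBought (k * n + v)%N = (chg k v == cap_of k v).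

Lemma wp_scenarios m0 : env m0 -> (forall v : 'I_n, m0 aRem v = rem_of v) ->
  wp scenarios_cmd m0 (fun m => (forall v : 'I_n, m aRem v = rem K v) /\ flags_ok m).
Proof.
move=> he hR; have hi : inputs m0 by case: he.
have E0 := first_scenarioE hi.
apply: wp_seq; apply: wp_assign => [_|]; rewrite E0; first exact: scenario_pos_bound.
set m1 := update _ _ _ _; have {}he : env m1 by [].
apply: (wp_for_scenarios (Inv := fun k m => [/\ m aP 0 = scenario_pos es scs k,
  forall v : 'I_n, m aRem v = rem k v &
  forall k' (v : 'I_n), (k' < k)%N ->
  m aReused (k' * n + v)%N = (base_of k' v <= chg k' v) /\
  m aBought (k' * n + v)%N = (chg k' v == cap_of k' v)])) => //.
- move=> k m hk ag hi' mk [hP IR IF].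
  have he' : env m by apply: env_agree ag _ he.
  have hpr := prob_bounds hk.
  have X1 : X <= X ^+ 3.
    by rewrite -[leLHS]expr1 ler_weXn2l // /X exprn_ege1.
  have X0 : 0 <= X by rewrite exprn_ge0.
  have E1 : eval m (!aD * aIn @ (!aP) / aIn @ (!aP + #1)) = pr k.
    rewrite /= (inputsE (j := scenario_pos es scs k + 0) hi'); last by rewrite hP; lia.
    rewrite (inputsE (j := scenario_pos es scs k + 1) hi'); last by rewrite hP; lia.
    by rewrite !encode_scenario //; case: he' => _ -> _ _ _.
  apply: wp_seq; apply: wp_assign => [_|]; rewrite E1; first by apply: cell_le; lia.
  set m2 := update _ _ _ _; have he2 : env m2 by [].
  apply: wp_seq; apply: wp_conseq (wp_limits hk he2 (erefl _) IR) _ => m3 ag3 HR3.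
  have he3 : env m3 by apply: env_agree ag3 _ he2.
  have hP3 : m3 aP 0 = scenario_pos es scs k by rewrite ag3.
  apply: wp_seq; apply: wp_conseq (wp_pay hk he3 hP3 HR3) _ => m4 ag4 HR4.
  have he4 : env m4 by apply: env_agree ag4 _ he3.
  apply: wp_seq; apply: wp_conseq (wp_charge hk he4 _ _ _ HR4) _.
  + by rewrite ag4 // ag3.
  + by rewrite ag4 // ag3.
  + by move=> v; rewrite ag4 // ag3 //; apply: IR.
  move=> m5 ag5 [J1 J2 J3 J4].
  have hi5 : inputs m5.
    by case: (env_agree ag5 isT he4).
  have hP5 : m5 aP 0 = scenario_pos es scs k by rewrite ag5 // ag4.
  have E' := next_scenarioE hk hi5 hP5.
  apply: wp_assign => [_|]; rewrite E'; first exact: scenario_pos_bound.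
  move=> _; split=> // k' v; rewrite ltnS leq_eqVlt => /orP[/eqP->|hk'].
    by split; [apply: J2 | apply: J3].
  have [e1 e2] := J4 k' v hk'; have [f1 f2] := IF k' v hk'.
  by split; [rewrite [LHS]e1 | rewrite [LHS]e2]; rewrite ag4 // ag3.
- by move=> m _ _ [_ h1 h2].
Qed.

Let reserved_at v := reserves scen cap_of base_of rem_of K v.

Lemma wp_output m0 :
  inputs m0 -> (forall v : 'I_n, m0 aRem v = rem K v) -> flags_ok m0 ->
  wp output_cmd m0 (fun m =>
    (forall v : 'I_n, m aReserved v = reserved_at v) /\
    (forall k (v : 'I_n), (k < K)%N ->
       m aReused (k * n + v)%N = (reserved_at v && (base_of k v <= chg k v)) /\
       m aBought (k * n + v)%N = (~~ reserved_at v && (chg k v == cap_of k v)))).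
Proof.
move=> hi hR hg.
have cell1 (b : bool) : (`|b%:Z| <= 2 ^ l)%N by case: b => //=; rewrite expn_gt0.
have Ei (m' : memory) (k : nat) (v : 'I_n) :
    m' aK 0 = k -> m' aIn 0 = n -> m' aI 0 = v ->
    eval m' (!aK * aIn @ #0 + !aI) = (k * n + v)%N.
  by move=> /= -> -> ->; lia.
pose fin (m : memory) k (v : 'I_n) :=
  m aReused (k * n + v)%N = (reserved_at v && (base_of k v <= chg k v)) /\
  m aBought (k * n + v)%N = (~~ reserved_at v && (chg k v == cap_of k v)).
pose raw (m : memory) k (v : 'I_n) :=
  m aReused (k * n + v)%N = (base_of k v <= chg k v) /\
  m aBought (k * n + v)%N = (chg k v == cap_of k v).
apply: (wp_for_vertices (Inv := fun i m =>
  (forall v : 'I_n, (v < i)%N -> m aReserved v = reserved_at v) /\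
  (forall k (v : 'I_n), (k < K)%N ->
     if (v < i)%N then fin m k v else raw m k v))) => //.
- move=> v m ag hi' mi [I1 I2].
  have E1 : eval m (aRem @ (!aI) == #0) = reserved_at v.
    by rewrite /= mi ag // hR.
  apply: wp_seq; apply: wp_assign => [_|]; rewrite E1 //.
  rewrite (_ : eval m (!aI) = v) //; set m1 := update _ _ _ _.
  (* Masking proceeds vertex by vertex; for [v] itself the first [j] scenarios are done. The cell
     treated next is still raw, so each cell is masked once. *)
  apply: (wp_for_scenarios (Inv := fun j m' => forall k (u : 'I_n), (k < K)%N ->
    if (u < v)%N || (u == v) && (k < j)%N then fin m' k u else raw m' k u)) => //.
  + by move=> k u hk; rewrite ltn0 andbF orbF; apply: I2.
  + move=> k m2 hk ag2 hi2 mk J.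
    have m2i : m2 aI 0 = v by rewrite ag2.
    have m2r : m2 aReserved v = reserved_at v by rewrite ag2 // /m1 /update /= eqxx.
    have [r1 r2] : raw m2 k v by have := J k v hk; rewrite ltnn ltnn andbF.
    have E2 : eval m2 (aReused @ (!aK * aIn @ #0 + !aI) * aReserved @ (!aI))
        = (reserved_at v && (base_of k v <= chg k v)).
      rewrite -[LHS]/(m2 aReused (eval m2 (!aK * aIn @ #0 + !aI)) *
        m2 aReserved (m2 aI 0)).
      rewrite (Ei m2 k v mk (inputs_n hi2) m2i) // m2i m2r r1.
      by case: (reserved_at v); case: (_ <= _).
    apply: wp_seq; apply: wp_assign => [_|]; rewrite E2 //.
    rewrite (Ei m2 k v mk (inputs_n hi2) m2i) //; set m3 := update _ _ _ _.
    have E3 : eval m3 (aBought @ (!aK * aIn @ #0 + !aI) * (#1 - aReserved @ (!aI)))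
        = (~~ reserved_at v && (chg k v == cap_of k v)).
      rewrite -[LHS]/(m2 aBought (eval m3 (!aK * aIn @ #0 + !aI)) *
        (1 - m2 aReserved (m2 aI 0))).
      rewrite (Ei m3 k v mk (inputs_n hi2) m2i) // m2i m2r r2.
      by case: (reserved_at v); case: (_ == _).
    apply: wp_assign => [_|]; rewrite E3 //.
    rewrite (Ei m3 k v mk (inputs_n hi2) m2i) // => _ k' u hk'.
    rewrite /m3 /fin /raw /update /= !eqz_nat !cell_inj.
    have -> : (k' < k.+1)%N = (k' == k) || (k' < k)%N by rewrite ltnS leq_eqVlt.
    have := J k' u hk'; rewrite /fin /raw.
    by case: (eqVneq k' k) => [->|nk]; case: (eqVneq u v) => [->|nu] //=; rewrite orbT.
  + move=> m2 ag2 hi2 J; split=> [u|k u hk].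
      rewrite ltnS leq_eqVlt -[(u : nat) == v]/(u == v) => /orP[/eqP->|hu].
        by rewrite /update /= ag2 // /m1 /update /= eqxx.
      rewrite /update /= ag2 // /m1 /update /= eqz_nat ltn_eqF //; exact: I1.
    have := J k u hk; rewrite hk andbT.
    have -> // : (u < v.+1)%N = (u < v)%N || (u == v) by rewrite ltnS leq_eqVlt orbC.
- move=> m _ _ [I1 I2]; split=> [v|k v hk]; first exact: I1.
  by have := I2 k v hk; rewrite ltn_ord.
Qed.

Lemma program_correct : exists t m,
  [/\ exec program (load w) t m, (t <= (ccost program).[W] * l.+1)%N,
      forall v : 'I_n, m aReserved v = reserved_at v
    & forall k (v : 'I_n), (k < K)%N ->
       m aReused (k * n + v)%N = reuses scen cap_of base_of rem_of K k v /\
       m aBought (k * n + v)%N = buys scen cap_of base_of rem_of K k v].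
Proof.
suff H : wp program (load w) (fun m =>
    (forall v : 'I_n, m aReserved v = reserved_at v) /\
    (forall k (v : 'I_n), (k < K)%N ->
       m aReused (k * n + v)%N = (reserved_at v && (base_of k v <= chg k v)) /\
       m aBought (k * n + v)%N = (~~ reserved_at v && (chg k v == cap_of k v)))).
  have [|t [m [h1 h2 _ [h3 h4]]]] := H; last by exists t, m.
  (* The initial memory is bounded: each cell is 0 or an entry of the input, at most [2 ^ W]. *)
  move=> a i; case: a => [|a]; last by [].
  case: i => // i; rewrite loadE; apply: leq_trans (nth_le_word_size _ _) _.
  by rewrite leq_exp2l // /l -/w -/W; lia.
apply: wp_seq; apply: wp_conseq (wp_positions _) _ => // m1 _ hi1.
apply: wp_seq; apply: wp_conseq (wp_denominator hi1) _ => m2 ag2 hD2.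
have hi2 := inputs_agree ag2 isT hi1.
apply: wp_seq; apply: wp_conseq (wp_scale hi2 hD2) _ => m3 _ [he3 hR3].
apply: wp_seq; apply: wp_conseq (wp_scenarios he3 hR3) _ => m4 ag4 [hR4 hg4].
have [hi4 _ _ _ _] := env_agree ag4 isT he3.
exact: wp_output hi4 hR4 hg4.
Qed.

End Correctness.

(** * Scaling back to the objective *)

Lemma dvdz_prod (s : seq int) z : z \in s -> (z %| \prod_(x <- s) x)%Z.
Proof. by move=> h; rewrite (big_rem z) //= dvdz_mulr. Qed.

Lemma horner_mul_affine (q : {poly nat}) a b x :
  (q * (a%:P * 'X + b%:P)).[x] = (q.[x] * (a * x + b))%N.
Proof. by rewrite hornerM hornerD hornerMX !hornerC. Qed.

Section Presentation.

Variables (n : nat) (I : instance 'I_n).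
Variables (es : seq ('I_n * 'I_n)) (scs : seq (seq ('I_n * 'I_n))).
Hypothesis vI : valid I.
Hypothesis pI : presents I es scs.

Let K := size scs.
Let D := common_den I scs.
Let scen k := nth [::] scs k.
Let A_ k := edge_set (scen k).

(** The denominator is a factor of [D], so the integer division in [scaled] leaves no remainder. *)
Lemma scaledE q : denq q \in dens I scs ->
  (scaled I scs q)%:~R = D%:~R * q :> rat.
Proof.
move=> /dvdz_prod hd; have d0 : (denq q)%:~R != 0 :> rat by rewrite intr_eq0 denq_neq0.
apply: (mulIf d0); rewrite -intrM /scaled divzK; last by rewrite dvdz_mulr.
by rewrite intrM numqE mulrA.
Qed.

Lemma cost_dens v : denq (cost I v) \in dens I scs.
Proof.
rewrite mem_cat; apply/orP; left.
by apply: (map_f (fun v => denq (cost I v))); rewrite mem_enum.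
Qed.

Lemma sigma_dens : denq (sigma I) \in dens I scs.
Proof. by rewrite !mem_cat mem_head orbT. Qed.

Lemma lambda_dens : denq (lambda I) \in dens I scs.
Proof. by rewrite !mem_cat !inE eqxx !orbT. Qed.

Lemma prob_dens k : (k < K)%N -> denq (prob I (A_ k)) \in dens I scs.
Proof.
move=> hk; rewrite !mem_cat; apply/orP; right; apply/orP; right.
by apply: (map_f (fun s => denq (prob I (edge_set s)))); apply: mem_nth.
Qed.

Lemma scaled_ge0 q : 0 <= q -> 0 <= scaled I scs q.
Proof.
by move=> q0; rewrite divz_ge0 ?denq_gt0 // mulr_ge0 ?numq_ge0 // ltW // common_den_gt0.
Qed.

Lemma instance_bounds :
  [/\ forall v, 0 <= scaled I scs (cost I v), 0 <= scaled I scs (sigma I) <= D,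
      D <= scaled I scs (lambda I) & forall k, 0 <= scaled I scs (prob I (A_ k))].
Proof.
case: vI => _ h1 /andP[h2 h3] h4 [h5 _ _].
have D0 : 0 < D%:~R :> rat by rewrite ltr0z common_den_gt0.
split=> [v||| k]; rewrite ?scaled_ge0 ?(ltW h2) //=.
  by rewrite -(ler_int rat) scaledE ?sigma_dens // ger_pMr // ltW.
by rewrite -(ler_int rat) scaledE ?lambda_dens // ler_peMr // ltW.
Qed.

Lemma instance_nums :
  [/\ forall v, 0 <= numq (cost I v), 0 <= numq (sigma I),
      0 <= numq (lambda I) & forall k, 0 <= numq (prob I (A_ k))].
Proof.
case: vI => _ h1 /andP[h2 _] h4 [h5 _ _].
split=> [v||| k]; rewrite numq_ge0 ?(ltW h2) //.
exact: le_trans ler01 (ltW h4).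
Qed.

Lemma prob_gt0 k : (k < K)%N -> 0 < prob I (A_ k).
Proof.
case: pI => _ [_ h] _ hk; have := h (A_ k); rewrite inE => <-.
by apply: map_f; apply: mem_nth.
Qed.

Lemma mem_scenario k p : p \in scen k -> edge_of p \in A_ k.
Proof. by move=> h; rewrite inE map_f. Qed.

(** A listed scenario has positive probability, hence consists of edges of the graph, which have two
    elements; beyond [K] the default list is empty. *)
Lemma scenario_neq k : {in scen k, forall p : 'I_n * 'I_n, p.1 != p.2}.
Proof.
move=> p hp; have hk : (k < K)%N.
  by rewrite ltnNge; apply/negP => h; rewrite /scen nth_default in hp.
case: vI => h _ _ _ [_ hs _].
have := h _ (subsetP (hs _ (prob_gt0 hk)) _ (mem_scenario hp)).
by rewrite /edge_of cards2; case: eqP.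
Qed.

(** Scenarios of probability 0 contribute nothing, and each of the others is listed exactly once. *)
Lemma expectE (X : {set {set 'I_n}} -> rat) :
  expect I X = \sum_(k < K) prob I (A_ k) * X (A_ k).
Proof.
case: pI => _ [u h] _; case: vI => _ _ _ _ [p0 _ _].
rewrite /expect (bigID (fun A => 0 < prob I A)) /= [X in _ + X]big1 ?addr0; last first.
  move=> A; rewrite -leNgt => hA.
  by rewrite (le_anti (introT andP (conj hA (p0 A)))) mul0r.
have hP A : (0 < prob I A) = (A \in map (@edge_set n) scs) by rewrite h inE.
by rewrite (eq_bigl _ _ hP) -big_uniq // big_map (big_nth [::]) big_mkord.
Qed.

(** The listed edge sets are distinct, so [decode] finds scenario [k] in row [k]. *)
Lemma scenario_index k : (k < K)%N -> index (A_ k) (map (@edge_set n) scs) = k.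
Proof.
move=> hk; case: pI => _ [u _] _.
by rewrite /A_ /scen -(nth_map [::] set0 (@edge_set n)) // index_uniq // size_map.
Qed.

(** This links the rational objective to the integer costs of the primal-dual scheme. *)
Lemma scaled_objective (S : solution 'I_n) :
  (D ^+ 3)%:~R * objective I S =
  (\sum_(v in reserved S) rem_of I scs v
   + \sum_(k < K) (\sum_(v in reused S (A_ k)) base_of I scs k v
                   + \sum_(v in bought S (A_ k)) cap_of I scs k v))%:~R.
Proof.
rewrite /objective !expectE /total_cost !intrD !rmorph_sum /= !mulrDr !exprSr expr0 mul1r.
rewrite !intrM -addrA; congr (_ + _).
  rewrite mulrA mulr_sumr; apply: eq_bigr => v _.
  by rewrite /rem_of !intrM !scaledE ?cost_dens ?sigma_dens // /D; ring.
rewrite !mulr_sumr -big_split /=; apply: eq_bigr => k _.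
rewrite intrD !rmorph_sum /= !mulr_sumr; congr (_ + _); apply: eq_bigr => v _.
  rewrite /base_of !intrM intrD intrN !scaledE ?cost_dens ?sigma_dens ?prob_dens //.
  by rewrite -/D -/(A_ k); ring.
rewrite /cap_of !intrM !scaledE ?cost_dens ?lambda_dens ?prob_dens //.
by rewrite -/(A_ k); ring.
Qed.

Lemma feasible_cover (S : solution 'I_n) k : feasible I S -> (k < K)%N ->
  reused S (A_ k) \subset reserved S /\
  {in scen k, forall p, (p.1 \in reused S (A_ k) :|: bought S (A_ k))
                     || (p.2 \in reused S (A_ k) :|: bought S (A_ k))}.
Proof.
move=> hS hk; have [h1 h2] := hS _ (prob_gt0 hk); split=> // p hp.
have [v] := h2 _ (mem_scenario hp).
by rewrite !inE => /orP[] /eqP -> ->; rewrite ?orbT.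
Qed.

Let reserved_at v := reserves scen (cap_of I scs) (base_of I scs) (rem_of I scs) K v.
Let reused_at k v := reuses scen (cap_of I scs) (base_of I scs) (rem_of I scs) K k v.
Let bought_at k v := buys scen (cap_of I scs) (base_of I scs) (rem_of I scs) K k v.

Variable m : memory.
Hypothesis m_rsv : forall v : 'I_n, m 1%N v = reserved_at v.
Hypothesis m_rows : forall k (v : 'I_n), (k < K)%N ->
  m 2%N (k * n + v)%N = reused_at k v /\ m 3%N (k * n + v)%N = bought_at k v.

Lemma mem_reserved v : (v \in reserved (decode scs m)) = reserved_at v.
Proof. by rewrite inE m_rsv; case: (reserved_at v). Qed.

Lemma mem_reused k v : (k < K)%N ->
  (v \in reused (decode scs m) (A_ k)) = reused_at k v.
Proof.
move=> hk; rewrite inE scenario_index // (proj1 (m_rows v hk)).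
by case: (reused_at k v).
Qed.

Lemma mem_bought k v : (k < K)%N ->
  (v \in bought (decode scs m) (A_ k)) = bought_at k v.
Proof.
move=> hk; rewrite inE scenario_index // (proj2 (m_rows v hk)).
by case: (bought_at k v).
Qed.

Let base_ge0 k v : 0 <= base_of I scs k v.
Proof. by case/andP: (base_of_bounds es instance_bounds k v). Qed.

Let base_le_cap k v : base_of I scs k v <= cap_of I scs k v.
Proof. by case/andP: (base_of_bounds es instance_bounds k v). Qed.

Let rem_ge0 v : 0 <= rem_of I scs v.
Proof. by case/andP: (rem_of_bounds es instance_bounds instance_nums v). Qed.

Lemma decode_feasible : feasible I (decode scs m).
Proof.
move=> A; case: pI => _ [_ h] _ hA.
have : A \in map (@edge_set n) scs by rewrite h inE.
case/(nthP set0) => k; rewrite size_map => hk; rewrite (nth_map [::]) // => <- {A hA}.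
split=> [|e].
  by apply/subsetP => v; rewrite mem_reused // mem_reserved => /andP[].
rewrite inE => /mapP[p hp ->].
have [v hv hc] := chosen_cover base_ge0 base_le_cap rem_ge0 hk hp.
exists v; first by rewrite !inE.
by rewrite inE mem_reused // mem_bought.
Qed.

Lemma decode_2approx (S : solution 'I_n) : feasible I S ->
  objective I (decode scs m) <= 2 * objective I S.
Proof.
move=> hS.
have D0 : 0 < (D ^+ 3)%:~R :> rat by rewrite ltr0z exprn_gt0 // common_den_gt0.
(* Multiplication by [D ^+ 3 > 0] turns the claim into the integer inequality of
   [primal_dual_2approx]. *)
rewrite -(ler_pM2l D0) mulrCA !scaled_objective -[2 in leRHS]/(2%:~R) -intrM ler_int.
have := primal_dual_2approx base_ge0 base_le_cap rem_ge0 scenario_neq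
  (fun k hk => proj1 (feasible_cover hS hk)) (fun k hk => proj2 (feasible_cover hS hk)).
congr (_ <= _); congr (_ + _); first by apply: eq_bigl => v; rewrite mem_reserved.
apply: eq_bigr => k _; congr (_ + _); apply: eq_bigl => v.
  by rewrite mem_reused.
by rewrite mem_bought.
Qed.

End Presentation.

Theorem theorem4 :
  exists (prog : cmd) (p : {poly nat}),
  forall (n : nat) (I : instance 'I_n)
    (es : seq ('I_n * 'I_n)) (scs : seq (seq ('I_n * 'I_n))),
  valid I -> presents I es scs ->
  exists (t : nat) (m : memory),
    [/\ exec prog (load (encode I es scs)) t m,
        (t <= p.[word_size (encode I es scs)])%N,
        feasible I (decode scs m)
      & forall S : solution 'I_n, feasible I S ->
          objective I (decode scs m) <= 2 * objective I S].
Proof.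
(* [ccost] counts in units of [l.+1], which is [6 * W + 3] for [l = 6 * W + 2]. *)
exists program, (ccost program * (6%N%:P * 'X + 3%N%:P)) => n I es scs vI pI.
have [t [m [h1 h2 h3 h4]]] :=
  program_correct es (instance_bounds scs vI) (scenario_neq vI pI) (instance_nums scs vI).
exists t, m; split=> //.
- by rewrite horner_mul_affine addnS.
- exact: (decode_feasible vI pI h3 h4).
- by move=> S; apply: (decode_2approx vI pI h3 h4).
Qed.
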